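(* Fix an integer $g\ge 2$ and set $t_g=\frac{1}{g^2(g-1)}$ and $s_g=\frac{1}{g(g-1)^2}$. Define $$A_{g-1}(x)=\frac{(x-g)x^{g-1}+(x-1)^g+t_g\,x^2(x-1)\big((x-g)x^{g-1}-(x-1)^g\big)}{x-g},$$ $$A_{g-2}(x)=\frac{(x-g)x^{g-1}+(x-1)^g+s_g\,x(x-1)^2\big((x-g)x^{g-1}-(x-1)^g\big)}{x-g},$$ and consider the curves over $\mathbb{Q}$ $$C_{g,g-1}:\ y^2=f_{t_g}(x):=A_{g-1}(x)^2-4t_g x^{2g}(x-1),\qquad C_{g,g-2}:\ y^2=f_{s_g}(x):=A_{g-2}(x)^2-4s_g x^{2g-1}(x-1)^2.$$ Then $C_{g,g-1}$ and $C_{g,g-2}$ are hyperelliptic curves of genus $g$ over $\mathbb{Q}$, there is a torsion divisor on $C_{g,g-1}$ of order $4g^2+2g-2$, and there is a torsion divisor on $C_{g,g-2}$ of order $4g^2+2g-4$.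
   Context: For a hyperelliptic curve $C: y^2=f(x)$ over a number field $K$ with $f$ of odd degree $2g+1$ and no repeated factors, $C$ has a single point at infinity $P_\infty$, which is $K$-rational. For a point $P\in C(K)$, the divisor $P-P_\infty$ defines a point of the Jacobian $J(K)$ of $C$ via its divisor class; $P-P_\infty$ is called a torsion divisor of order $N$ if its class in $J$ has order $N$. *)

(* Defs.v *)
From HB Require Import structures.
From mathcomp Require Import all_boot all_order all_algebra all_field.
From mathcomp.multinomials Require Import freeg.

Set Implicit Arguments.
Unset Strict Implicit.
Unset Printing Implicit Defensive.

Import GRing.Theory Num.Theory.
Local Open Scope ring_scope.

(* The curve y^2 = f(x) has genus g when f has degree 2g+1 (the case with one
   point at infinity) and no repeated factors. *)
Definition hyperelliptic (k : fieldType) (g : nat) (f : {poly k}) : Prop :=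
  size f = (2 * g + 2)%N /\
  (forall q : {poly k}, (1 < size q)%N -> ~~ (q ^+ 2 %| f)).

(* The coordinate ring k[x,y]/(y^2 - F) of a plane chart: the pair (a, b) is
   the residue class of a(x) + b(x) y. *)
Section Chart.

Variables (k : fieldType) (F : {poly k}).

Definition regular : Type := ({poly k} * {poly k})%type.

Definition reg_mul (G H : regular) : regular :=
  (G.1 * H.1 + G.2 * H.2 * F, G.1 * H.2 + G.2 * H.1).

Definition reg_exp (G : regular) (n : nat) : regular :=
  iter n (reg_mul G) (1, 0).

Definition reg_eval (G : regular) (p : k * k) : k :=
  G.1.[p.1] + G.2.[p.1] * p.2.

(* A uniformizer at the smooth point p = (x0, y0): y if y0 = 0, else x - x0
   (for 2 invertible in k). *)
Definition uniformizer (p : k * k) : regular :=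
  if p.2 == 0 then (0, 1) else ('X - p.1%:P, 0).

(* ord_p(G) = n: G = u^n S / T with u a uniformizer at p and S, T regular and
   non-vanishing at p. *)
Definition vanishing_order (p : k * k) (G : regular) (n : nat) : Prop :=
  exists S T : regular,
    [/\ reg_eval S p != 0, reg_eval T p != 0
      & reg_mul G T = reg_mul (reg_exp (uniformizer p) n) S].

End Chart.

(* The smooth projective model of y^2 = f(x), for f of degree 2g+1, is the curve
   Y^2 = f(X/Z) Z^(2g+2) in the weighted projective plane P(1, g+1, 1). It is
   covered by the chart Z = 1, with equation y^2 = f(x), and the chart X = 1,
   with coordinates v = Z/X, w = Y/X^(g+1) and equation w^2 = v^(2g+2) f(1/v),
   whose only additional point is P_infinity = (0, 0). *)
Section Curve.

Variables (k : fieldType) (g : nat) (f : {poly k}).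

Definition point : Type := option {p : k * k | p.2 ^+ 2 == f.[p.1]}.

HB.instance Definition _ := Choice.on point.

Definition infty : point := None.

(* v^d a(1/v) *)
Definition reverse (d : nat) (a : {poly k}) : {poly k} :=
  \poly_(i < d.+1) a`_(d - i).

(* (a, b) dehomogenizes a form a(X,Z) + b(X,Z) Y of weight d: a is homogeneous
   of degree d and b of degree d - (g+1), hence b = 0 when d <= g. *)
Definition form (d : nat) (G : regular k) : bool :=
  (size G.1 <= d.+1)%N && (size G.2 <= d - g)%N.

(* The same form of weight d read in the chart X = 1. *)
Definition form_infty (d : nat) (G : regular k) : regular k :=
  (reverse d G.1, if (g < d)%N then reverse (d - g.+1) G.2 else 0).

Definition form_order (d : nat) (G : regular k) (Q : point) (n : nat) : Prop :=
  match Q with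
  | Some p => vanishing_order f (val p) G n
  | None =>
      vanishing_order (reverse (2 * g + 2) f) (0, 0) (form_infty d G) n
  end.

Notation divisor := {freeg point}.

(* D = div(h) for some nonzero rational function h = G / H on the curve, G and H
   being nonzero forms of the same weight. *)
Definition principal (D : divisor) : Prop :=
  exists (d : nat) (G H : regular k),
    [/\ form d G, form d H, G != 0, H != 0
      & forall Q : point, exists m n : nat,
          [/\ form_order d G Q m, form_order d H Q n
            & coeff Q D = m%:Z - n%:Z]].

(* The order of the class of D in the group of divisors modulo principal ones. *)
Definition class_order (D : divisor) (N : nat) : Prop :=
  [/\ (0 < N)%N, principal (D *+ N)
    & forall m : nat, (0 < m)%N -> principal (D *+ m) -> (N <= m)%N].

End Curve.

Arguments infty {k f}.

Section BaseChange.

Variables (k K : fieldType) (s : {rmorphism k -> K}) (f : {poly k}).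

Lemma base_point_subproof (p : {p : k * k | p.2 ^+ 2 == f.[p.1]}) :
  (s (val p).2) ^+ 2 == (map_poly s f).[s (val p).1].
Proof. by rewrite -rmorphXn horner_map (eqP (valP p)). Qed.

Definition base_point (P : point f) : point (map_poly s f) :=
  omap (fun p => exist (fun q : K * K => q.2 ^+ 2 == (map_poly s f).[q.1])
                   (s (val p).1, s (val p).2) (base_point_subproof p)) P.

End BaseChange.

(* For P in C(Q), the class of P - P_infinity in J(Q), a subgroup of
   J(Qbar) = Pic^0 of C over Qbar, has order N. *)
Definition torsion_divisor (g : nat) (f : {poly rat}) (P : point f) (N : nat) :
    Prop :=
  class_order g
    (<< base_point (ratr : {rmorphism rat -> algC}) P >> - << infty >>
      : {freeg (point (map_poly (ratr : rat -> algC) f))}) N.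

Section Family.

Variable g : nat.

Definition t_ : rat := 1 / (g ^ 2 * (g - 1))%N%:R.
Definition s_ : rat := 1 / (g * (g - 1) ^ 2)%N%:R.

Let U : {poly rat} := ('X - g%:R%:P) * 'X^(g - 1).
Let V : {poly rat} := ('X - 1) ^+ g.

Definition numA_gm1 : {poly rat} :=
  U + V + t_ *: ('X^2 * ('X - 1)) * (U - V).
Definition numA_gm2 : {poly rat} :=
  U + V + s_ *: ('X * ('X - 1) ^+ 2) * (U - V).

(* The divisions by x - g are exact, see A_gm1E and A_gm2E. *)
Definition A_gm1 : {poly rat} := numA_gm1 %/ ('X - g%:R%:P).
Definition A_gm2 : {poly rat} := numA_gm2 %/ ('X - g%:R%:P).

Definition f_t : {poly rat} :=
  A_gm1 ^+ 2 - (4 * t_) *: ('X^(2 * g) * ('X - 1)).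
Definition f_s : {poly rat} :=
  A_gm2 ^+ 2 - (4 * s_) *: ('X^(2 * g - 1) * ('X - 1) ^+ 2).

Lemma A_gm1E : (2 <= g)%N -> A_gm1 * ('X - g%:R%:P) = numA_gm1.
Proof.
move=> g2; apply: divpK; rewrite dvdp_XsubCl rootE /numA_gm1 /U /V.
have g1 : (g - 1)%N%:R = g%:R - 1 :> rat by rewrite natrB // ltnW.
have nz : (g ^ 2 * (g - 1))%N%:R != 0 :> rat.
  by rewrite pnatr_eq0 -lt0n muln_gt0 expn_gt0 subn_gt0 ltnW.
rewrite !(hornerD, hornerN, hornerM, hornerZ, horner_exp, hornerX, hornerC).
rewrite subrr !mul0r !add0r.
by rewrite -g1 mulrN -!natrM mulnn /t_ mul1r mulVf // mul1r subrr.
Qed.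

Lemma A_gm2E : (2 <= g)%N -> A_gm2 * ('X - g%:R%:P) = numA_gm2.
Proof.
move=> g2; apply: divpK; rewrite dvdp_XsubCl rootE /numA_gm2 /U /V.
have g1 : (g - 1)%N%:R = g%:R - 1 :> rat by rewrite natrB // ltnW.
have nz : (g * (g - 1) ^ 2)%N%:R != 0 :> rat.
  by rewrite pnatr_eq0 -lt0n muln_gt0 expn_gt0 subn_gt0 g2 ltnW.
rewrite !(hornerD, hornerN, hornerM, hornerZ, horner_exp, hornerX, hornerC).
rewrite subrr !mul0r !add0r.
by rewrite -g1 mulrN -!natrM mulnn /s_ mul1r mulVf // mul1r subrr.
Qed.

End Family.

(* Main.v *)
(* Write [U = (x - g) x^(g-1)], [V = (x - 1)^g], [S = U + V], [D = U - V], and let [T]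
   be [t_g x^2 (x - 1)] or [s_g x (x - 1)^2]. The functions [y - A] and
   [(x - g) y - (S - T D)] have norms proportional to [T U^2 / (x - g)^2] and
   [T V^2], so their zeros lie at two points [P] and [Q] above [x = 0] and [x = 1],
   which gives relations [a P + Q = 0] and [2 P + b Q = 0] in the Jacobian and hence
   [(a b - 2) P = 0]. A function with at most [2g] poles at infinity and none
   elsewhere is a polynomial in [x], so [u P + v Q = 0] with [|u| + |v| <= 2g] forces
   [u = v = 0], and counting the points of the l1-ball of radius [g] shows that the
   order of [P] is not a proper divisor of [a b - 2].

   The curve is smooth: [(x - g)^2 f = (1 - T) (S^2 - T D^2)], and a double root of
   [f] is a common root of an explicit integral quartic and a trinomial in [x^g] and
   [(x - 1)^g]. A primitive common factor of these would take the value [1] or [-1]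
   at a suitable integer, which is impossible because the roots of the quartic are
   at distance more than 1 from it, apart from a few small [g]. *)

Require Import Defs.
From HB Require Import structures.
From mathcomp Require Import all_boot all_order all_algebra all_field.
From mathcomp Require Import ring lra zify.
From mathcomp.multinomials Require Import freeg.

Set Implicit Arguments.
Unset Strict Implicit.
Unset Printing Implicit Defensive.

Import Order.TTheory GRing.Theory Num.Theory.
Local Open Scope ring_scope.

(** * The coordinate ring of a chart *)

(** The type [regular k] forgets [F], while the product depends on it. This alias keeps [F] in the
    type, so that each chart carries its own ring structure. *)
Definition chart (k : fieldType) (F : {poly k}) : Type := regular k.

Section ChartRing.

Variables (k : fieldType) (F : {poly k}).
Implicit Types G H : chart F.

HB.instance Definition _ :=
  GRing.Zmodule.copy (chart F) ({poly k} * {poly k})%type.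

Let chart_one : chart F := (1, 0).
Let chart_mul : chart F -> chart F -> chart F := @reg_mul k F.

Let chart_mulA : associative chart_mul.
Proof. by move=> [a b] [c d] [u v]; congr pair; rewrite /=; ring. Qed.

Let chart_mulC : commutative chart_mul.
Proof. by move=> [a b] [c d]; congr pair; rewrite /=; ring. Qed.

Let chart_mul1 : left_id chart_one chart_mul.
Proof. by move=> [a b]; congr pair; rewrite /=; ring. Qed.

Let chart_mulD : left_distributive chart_mul +%R.
Proof. by move=> [a b] [c d] [u v]; congr pair; rewrite /=; ring. Qed.

Let chart_neq0 : chart_one != 0.
Proof. by rewrite -pair_eqE /= oner_eq0. Qed.

HB.instance Definition _ := GRing.Zmodule_isComNzRing.Build (chart F)
  chart_mulA chart_mulC chart_mul1 chart_mulD chart_neq0.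

Definition of_poly (a : {poly k}) : chart F := (a, 0).

Definition conj G : chart F := (G.1, - G.2).

(** The norm of the quadratic extension [k(x, y) / k(x)]. *)
Definition norm G : {poly k} := G.1 ^+ 2 - G.2 ^+ 2 * F.

Lemma chart_expE G n : G ^+ n = reg_exp F G n.
Proof. by elim: n => // n IHn; rewrite exprS IHn. Qed.

Lemma of_polyM a b : of_poly (a * b) = of_poly a * of_poly b.
Proof. by congr pair; rewrite /=; ring. Qed.

Lemma of_polyX a n : of_poly (a ^+ n) = of_poly a ^+ n.
Proof. by elim: n => // n IHn; rewrite !exprS of_polyM IHn. Qed.

Lemma mul_conj G : G * conj G = of_poly (norm G).
Proof. by case: G => a b; congr pair; rewrite /norm /=; ring. Qed.

Lemma norm_conj G : norm (conj G) = norm G.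
Proof. by rewrite /norm /= sqrrN. Qed.

Lemma normM G H : norm (G * H) = norm G * norm H.
Proof. by case: G => a b; case: H => c d; rewrite /norm /=; ring. Qed.

Lemma normX G n : norm (G ^+ n) = norm G ^+ n.
Proof.
elim: n => [|n IHn]; last by rewrite !exprS normM IHn.
by rewrite /norm /= expr1n expr0n /= mul0r subr0.
Qed.

Lemma norm_of_poly a : norm (of_poly a) = a ^+ 2.
Proof. by rewrite /norm /= expr0n /= mul0r subr0. Qed.

(** * Orders of vanishing at a point of a chart *)

Section AtPoint.

Variable p : k * k.
Hypothesis on_curve : p.2 ^+ 2 = F.[p.1].

Lemma evalM G H : reg_eval (G * H) p = reg_eval G p * reg_eval H p.
Proof.
by case: G => a b; case: H => c d; rewrite /reg_eval /= !hornerE -on_curve; ring.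
Qed.

Lemma eval1 : reg_eval (1 : chart F) p = 1.
Proof. by rewrite /reg_eval /= !hornerE. Qed.

Lemma eval_of_poly a : reg_eval (of_poly a) p = a.[p.1].
Proof. by rewrite /reg_eval /= !hornerE. Qed.

Lemma eval_norm G : reg_eval G p = 0 -> (norm G).[p.1] = 0.
Proof. by move=> G0; rewrite -eval_of_poly -mul_conj evalM G0 mul0r. Qed.

Let u : chart F := uniformizer p.

Lemma eval_uniformizer : reg_eval u p = 0.
Proof.
rewrite /u /uniformizer; case: eqP => [p0|_]; rewrite /reg_eval /= !hornerE //.
by rewrite subrr.
Qed.

Lemma vanishing_orderP G n :
  vanishing_order F p G n <->
  exists S T : chart F,
    [/\ reg_eval S p != 0, reg_eval T p != 0 & G * T = u ^+ n * S].
Proof.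
by split=> -[S [T [S0 T0 E]]]; exists S, T; split=> //;
  move: E; rewrite chart_expE.
Qed.

Lemma vanishing_order0 G : reg_eval G p != 0 -> vanishing_order F p G 0.
Proof.
move=> G0; apply/vanishing_orderP; exists G, 1; split=> //.
by rewrite eval1 oner_eq0.
Qed.

Lemma vanishing_orderM G H m n :
  vanishing_order F p G m -> vanishing_order F p H n ->
  vanishing_order F p ((G * H : chart F) : regular k) (m + n).
Proof.
move=> /vanishing_orderP[S [T [S0 T0 E]]] /vanishing_orderP[S' [T' [S0' T0' E']]].
apply/vanishing_orderP; exists (S * S'), (T * T'); rewrite !evalM !mulf_neq0 //.
by split=> //; rewrite mulrACA E E' exprD; ring.
Qed.

Hypothesis F0 : F != 0.

(** Multiplication by [y] sends [(a, b)] to [(b F, a)], and multiplication by [x - x0] acts on each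
    component; both maps are injective. *)
Lemma uniformizer_regular H : u * H = 0 -> H = 0.
Proof.
rewrite /u /uniformizer; case: H => a b; case: eqP => _ [] /=.
  rewrite !mul0r mul1r !add0r => /eqP; rewrite mul1r mulf_eq0 (negPf F0) orbF.
  by move=> /eqP-> ->.
rewrite !mul0r !addr0 => /eqP; rewrite mulf_eq0 polyXsubC_eq0 => /eqP->.
by move=> /eqP; rewrite mulf_eq0 polyXsubC_eq0 => /eqP->.
Qed.

Lemma uniformizerI n G H : u ^+ n * G = u ^+ n * H -> G = H.
Proof.
elim: n => [|n IHn]; first by rewrite !mul1r.
rewrite exprS -!mulrA => /eqP; rewrite -subr_eq0 -mulrBr => /eqP.
by move/uniformizer_regular/eqP; rewrite subr_eq0 => /eqP/IHn.
Qed.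

Lemma uniformizer_lt m n G H :
  (m < n)%N -> u ^+ m * G = u ^+ n * H -> reg_eval G p = 0.
Proof.
move=> lt_mn; rewrite -(subnKC lt_mn) addSnnS exprD -mulrA => /uniformizerI->.
by rewrite exprS -mulrA evalM eval_uniformizer mul0r.
Qed.

Lemma vanishing_order_uniq G m n :
  vanishing_order F p G m -> vanishing_order F p G n -> m = n.
Proof.
wlog: m n / (m <= n)%N => [wl|le_mn].
  by case/orP: (leq_total m n) => /wl{}wl ? ?; [|symmetry]; apply: wl.
move=> /vanishing_orderP[S [T [S0 T0 E]]] /vanishing_orderP[S' [T' [S0' T0' E']]].
move: le_mn; rewrite leq_eqVlt => /predU1P[//|lt_mn].
have /(uniformizer_lt lt_mn)/eqP : u ^+ m * (S * T') = u ^+ n * (S' * T).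
  by rewrite !mulrA -E -E'; ring.
by rewrite evalM mulf_eq0 (negPf S0) (negPf T0').
Qed.

(** This is divisibility in the local ring at [p], where [T] is a unit. *)
Lemma vanishing_order_dvd G H m n :
  vanishing_order F p G m -> vanishing_order F p H n -> (n <= m)%N ->
  exists S T : chart F, reg_eval T p != 0 /\ G * T = H * S.
Proof.
move=> /vanishing_orderP[S [T [S0 T0 E]]] /vanishing_orderP[S' [T' [S0' T0' E']]].
move=> le_nm; exists (u ^+ (m - n) * S * T'), (T * S').
split; first by rewrite evalM mulf_neq0.
transitivity (u ^+ (m - n) * S * (u ^+ n * S')); last by rewrite -E'; ring.
by rewrite mulrA E -{1}(subnK le_nm) exprD; ring.
Qed.

Lemma vanishing_order_quotient G H m n :
  vanishing_order F p ((H * G : chart F) : regular k) m ->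
  vanishing_order F p H n -> (n <= m)%N ->
  (reg_eval G p == 0) = (n != m).
Proof.
move=> /vanishing_orderP[S [T [S0 T0 E]]] /vanishing_orderP[S' [T' [S0' T0' E']]].
have E2 : u ^+ n * (S' * G * T) = u ^+ m * (S * T').
  by rewrite !mulrA -E -E'; ring.
rewrite leq_eqVlt => /predU1P[eq_nm|lt_nm].
  rewrite eq_nm eqxx; apply/negbTE; move: E2; rewrite eq_nm => /uniformizerI E2.
  have : reg_eval (S * T') p != 0 by rewrite evalM mulf_neq0.
  by rewrite -E2 !evalM !mulf_eq0 !negb_or => /andP[/andP[]].
rewrite neq_ltn lt_nm; move/eqP: (uniformizer_lt lt_nm E2).
by rewrite !evalM !mulf_eq0 (negPf S0') (negPf T0) orbF.
Qed.

End AtPoint.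

End ChartRing.

(** * Norms, pole orders and the point at infinity *)

Section OddDegree.

Variables (k : fieldType) (g : nat) (f : {poly k}).
Hypothesis size_f : size f = (2 * g + 2)%N.
Implicit Types G H : chart f.

Let f0 : f != 0.
Proof. by rewrite -size_poly_gt0 size_f addn2. Qed.

(* [a ^+ 2] and [b ^+ 2 * f] have degrees of opposite parities. *)
Lemma size_norm G :
  size (norm G) =
  maxn (size G.1).*2.-1 (if G.2 == 0 then 0 else (size G.2 + g).*2).
Proof.
case: G => a b; rewrite /norm /=.
have sa : size (a ^+ 2) = (size a).*2.-1.
  have [->|a0] := eqVneq a 0; first by rewrite expr0n /= size_poly0.
  by rewrite expr2 size_mul // addnn.
have [->|b0] := eqVneq b 0.
  by rewrite expr0n /= mul0r subr0 sa maxn0.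
have sb : size (b ^+ 2 * f) = (size b + g).*2.
  rewrite size_mul ?expf_neq0 // expr2 size_mul // size_f.
  have aux s : (0 < s)%N -> ((s + s).-1 + (2 * g + 2)).-1 = (s + g).*2 by lia.
  by apply: aux; rewrite size_poly_gt0.
case: (ltngtP (size (a ^+ 2)) (size (b ^+ 2 * f))) => [lt|lt|eq].
- rewrite addrC size_polyDl size_polyN // -sa -sb.
  by symmetry; apply/maxn_idPr/ltnW.
- by rewrite size_polyDl ?size_polyN // -sa -sb; symmetry; apply/maxn_idPl/ltnW.
- have : (0 < size b)%N by rewrite size_poly_gt0.
  by move: eq; rewrite sa sb; lia.
Qed.

(** No cancellation can occur in the norm, by parity of degrees. As the norm is multiplicative, the
    coordinate ring is a domain. *)
Lemma norm_eq0 G : (norm G == 0) = (G == 0).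
Proof.
apply/eqP/eqP => [|->]; last by rewrite /norm /= !expr0n /= mul0r subrr.
move/(congr1 (fun q : {poly k} => size q)); rewrite size_norm size_poly0.
case: G => a b /=; case: eqP => [->|/eqP b0].
  rewrite maxn0 => sa; suff -> : a = 0 by [].
  by apply/eqP; rewrite -size_poly_leq0; move: (size a) sa; lia.
by move: b0; rewrite -size_poly_gt0; move: (size a) (size b); lia.
Qed.

Lemma chart_mulf_neq0 G H : G != 0 -> H != 0 -> G * H != 0.
Proof. by rewrite -!norm_eq0 normM; apply: mulf_neq0. Qed.

Lemma chart_mulfI G H1 H2 : G != 0 -> G * H1 = G * H2 -> H1 = H2.
Proof.
move=> G0 /eqP; rewrite -subr_eq0 -mulrBr => E; apply/eqP; rewrite -subr_eq0.
by apply: contraLR E; apply: chart_mulf_neq0.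
Qed.

(** The order of the pole at infinity: there [x] has a pole of order 2 and [y] one of order
    [2g + 1], so that of [a + b y] is the larger of [2 deg a] and [2 deg b + 2g + 1], which is the
    degree of the norm. *)
Definition pole G : nat := (size (norm G)).-1.

Lemma poleM G H : G != 0 -> H != 0 -> pole (G * H) = (pole G + pole H)%N.
Proof.
rewrite /pole -!norm_eq0 normM => G0 H0; rewrite size_mul //.
by move: G0 H0; rewrite -!size_poly_gt0; move: (size _) (size _); lia.
Qed.

Lemma pole_small G : (pole G <= 2 * g)%N -> G.2 = 0.
Proof.
rewrite /pole size_norm; case: G => a b /=; case: eqP => // /eqP.
by rewrite -size_poly_gt0; move: (size a) (size b); lia.
Qed.

Lemma reverseE (d : nat) (a : {poly k}) : (size a <= d.+1)%N ->
  reverse d a =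
  'X^(d.+1 - size a) * \poly_(i < size a) a`_((size a).-1 - i).
Proof.
move=> sa; apply/polyP=> i; rewrite /reverse coef_poly coefXnM coef_poly.
case: ltnP => [lt_id|le_di].
  case: ltnP => [|le_i].
    by move=> lt_i; rewrite nth_default //; move: (size a) sa lt_i; lia.
  case: ltnP => [lt|]; last by move: (size a) sa le_i; lia.
  by congr (_`_ _); move: (size a) sa le_i lt; lia.
by case: ltnP => // ?; case: ltnP => //; move: (size a) sa; lia.
Qed.

(** The reversal of [a] at its own degree: its constant term is the leading coefficient of [a], so
    it is a unit at [v = 0] when [a] is nonzero. *)
Let unit_part (a : {poly k}) : {poly k} := \poly_(i < size a) a`_((size a).-1 - i).

Let unit_part0 a : a != 0 -> (unit_part a).[0] != 0.
Proof.
move=> a0; rewrite horner_coef0 coef_poly size_poly_gt0 a0 subn0.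
by rewrite -lead_coefE lead_coef_eq0.
Qed.

Let unit_part_0 : unit_part 0 = 0.
Proof. by apply/polyP=> i; rewrite /unit_part size_poly0 coef_poly ltn0 coef0. Qed.

Let F_infty := reverse (2 * g + 2) f.

(** The degree [2g + 1] of [f] is one less than the weight [2g + 2], which leaves exactly one factor
    [v]. *)
Let F_inftyE : F_infty = 'X * unit_part f.
Proof.
rewrite /F_infty reverseE; last by rewrite size_f.
by congr (_ * _); rewrite size_f subSnn.
Qed.

Lemma reverse_neq0 : F_infty != 0.
Proof.
rewrite F_inftyE mulf_neq0 ?polyX_eq0 //; apply/eqP => E.
by have := unit_part0 f0; rewrite E horner0 eqxx.
Qed.

Lemma infty_on_curve : ((0 : k), (0 : k)).2 ^+ 2 = F_infty.[((0 : k), (0 : k)).1].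
Proof. by rewrite F_inftyE /= !hornerE expr0n. Qed.

(* With [e] a unit at the origin, [v e = w ^+ 2] in the chart at infinity, so
   [v] vanishes there to order 2. *)
Let order_even m (c d : {poly k}) : c.[0] != 0 ->
  vanishing_order F_infty (0, 0) ('X^m * c, 'X^m * d) (2 * m).
Proof.
move=> c0; apply/vanishing_orderP; exists (c, d), (of_poly _ (unit_part f ^+ m)).
split; first by rewrite /reg_eval /= !hornerE.
  by rewrite eval_of_poly horner_exp expf_neq0 // unit_part0.
have -> : ('X^m * c, 'X^m * d) = of_poly F_infty 'X^m * (c, d).
  by congr pair; rewrite /=; ring.
have -> : (uniformizer ((0 : k), (0 : k)) : chart F_infty) ^+ (2 * m) =
          of_poly _ 'X^m * of_poly _ (unit_part f ^+ m).
  rewrite exprM -of_polyM -exprMn -F_inftyE of_polyX; congr (_ ^+ _).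
  by rewrite /uniformizer eqxx; congr pair; rewrite /=; ring.
by ring.
Qed.

(** With [e] the unit such that [v e = w ^+ 2], one has [e (v c + d w) = w (e d + c w)], and the
    last factor is a unit at the origin. *)
Let order_odd m (c d : {poly k}) : d.[0] != 0 ->
  vanishing_order F_infty (0, 0) ('X^m * ('X * c), 'X^m * d) (2 * m).+1.
Proof.
move=> d0; apply/vanishing_orderP.
exists (unit_part f * d, c), (of_poly _ (unit_part f ^+ m.+1)).
split; first by rewrite /reg_eval /= !hornerE mulf_neq0 // unit_part0.
  by rewrite eval_of_poly horner_exp expf_neq0 // unit_part0.
have E : (uniformizer ((0 : k), (0 : k)) : chart F_infty) ^+ (2 * m) =
          of_poly _ 'X^m * of_poly _ (unit_part f ^+ m).
  rewrite exprM -of_polyM -exprMn -F_inftyE of_polyX; congr (_ ^+ _).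
  by rewrite /uniformizer eqxx; congr pair; rewrite /=; ring.
rewrite [X in _ = X * _]exprS [X in _ = _ * X * _]E /uniformizer eqxx !exprS.
congr pair; rewrite /= F_inftyE; ring.
Qed.

(** In the chart [X = 1] the form becomes [v^d] times the function, and [v] has order 2. The pole
    order thus determines the order of the form. *)
Lemma form_order_infty d G : Defs.form g d G -> G != 0 ->
  exists2 n, form_order g d G (infty : point f) n & (n + pole G = 2 * d)%N.
Proof.
case: G => a b /andP[/= sa sb] ab0; rewrite /form_infty /= /pole size_norm /=.
have Eb : b != 0 -> (g < d)%N.
  by rewrite -size_poly_gt0; move: (size b) sb; lia.
(* The exponents of [v] in the two components, which have orders [2 al] and [2 be + 1] at infinity.
   These are distinct, so the smaller one is the order of the sum. *)
pose al := (d.+1 - size a)%N; pose be := (d - g - size b)%N.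
have Ea : reverse d a = 'X^al * unit_part a by apply: reverseE.
have {}Eb : (if (g < d)%N then reverse (d - g.+1) b else 0) = 'X^be * unit_part b.
  have [->|b0] := eqVneq b 0.
    rewrite unit_part_0 mulr0; case: ifP => // _.
    by apply/polyP=> i; rewrite coef_poly !coef0 if_same.
  rewrite Eb // reverseE.
    by congr ('X^_ * _); rewrite /be; move: (size b) (Eb b0); lia.
  by move: (size b) sb (Eb b0); lia.
rewrite {}Ea {}Eb.
have sa0 : (0 < size a)%N = (a != 0) by rewrite size_poly_gt0.
have sb0 : (0 < size b)%N = (b != 0) by rewrite size_poly_gt0.
have [b0|b0] := eqVneq b 0.
  have a0 : a != 0 by apply: contraNneq ab0 => ->; rewrite b0.
  exists (2 * al)%N; last by rewrite a0 in sa0; rewrite /al; move: (size a) sa sa0; lia.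
  rewrite b0 unit_part_0 mulr0.
  have := @order_even al (unit_part a) 0; rewrite mulr0; apply.
  exact: unit_part0.
rewrite b0 in sb0.
have [/andP[a0 le]|] := boolP ((a != 0) && (al <= be)%N).
  exists (2 * al)%N; last first.
    rewrite a0 in sa0; move: le; rewrite /al /be.
    by move: (size a) (size b) sa sb sa0 sb0; lia.
  rewrite -(subnKC le) exprD -mulrA; apply: order_even; exact: unit_part0.
rewrite negb_and negbK -ltnNge => lt.
exists (2 * be).+1; last first.
  case/orP: lt => [/eqP->|lt].
    by rewrite size_poly0 /be; move: (size b) sb sb0; lia.
  by move: lt; rewrite /al /be; move: (size a) (size b) sa sb sb0; lia.
suff [c ->] : exists c, 'X^al * unit_part a = 'X^be * ('X * c).
  by apply: order_odd; apply: unit_part0.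
case/orP: lt => [/eqP->|lt]; last first.
  exists ('X^(al - be.+1) * unit_part a).
  by rewrite !mulrA -exprSr -exprD subnKC.
by exists 0; rewrite unit_part_0 !mulr0.
Qed.

End OddDegree.

(** * Principal divisors over an algebraically closed field *)

Section ClosedCurve.

Variables (k : closedFieldType) (g : nat) (f : {poly k}).
Hypothesis size_f : size f = (2 * g + 2)%N.
Hypothesis two_neq0 : (2 : k) != 0.
Hypothesis separable_f : coprimep f f^`().
Implicit Types (G H : chart f) (c : point f -> int).

Let f0 : f != 0.
Proof. by rewrite -size_poly_gt0 size_f addn2. Qed.

Let of_poly_neq0 (n : {poly k}) : (of_poly f n != 0) = (n != 0).
Proof. by rewrite -(norm_eq0 size_f) norm_of_poly expf_eq0. Qed.

Lemma root_above (r : k) : exists y, y ^+ 2 = f.[r].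
Proof.
have /closed_rootP[y] : size ('X^2 - (f.[r])%:P) != 1%N by rewrite size_XnsubC.
by rewrite rootE !hornerE subr_eq0 => /eqP; exists y.
Qed.

(** If [f] does not vanish at [r], then [a + b y] vanishes at both points above [r], so [a] and [b]
    have the root [r]. If it does, there is one ramified point above [r]; separability makes [r] a
    simple root of [f], and dividing by [y] yields the root of [b]. *)
Lemma dvd_local_linear (r : k) G :
  (forall p : k * k, p.2 ^+ 2 = f.[p.1] ->
    exists S T : chart f,
      reg_eval T p != 0 /\ G * T = of_poly f ('X - r%:P) * S) ->
  exists H, G = of_poly f ('X - r%:P) * H.
Proof.
move=> loc; have [y Ey] := root_above r.
have ev0 z : z ^+ 2 = f.[r] -> reg_eval G (r, z) = 0.
  move=> Ez; have [S [T [T0 E]]] := loc (r, z) Ez.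
  have /eqP := congr1 (fun H : chart f => reg_eval H (r, z)) E.
  rewrite !evalM // eval_of_poly !hornerE subrr mul0r mulf_eq0 (negPf T0) orbF.
  by move/eqP.
case: G => a b in loc ev0 *; rewrite /reg_eval /= in ev0.
suff [/factor_theorem[a' ->] /factor_theorem[b' ->]] : root a r /\ root b r.
  by exists (a', b'); congr pair; rewrite /=; ring.
have := ev0 y Ey; have [y0|y0] := eqVneq y 0.
  rewrite y0 mulr0 addr0 => a0; split; first exact/eqP.
  have rf : root f r by rewrite rootE -Ey y0 expr0n.
  have [h Ef] := factor_theorem _ _ rf.
  have h0 : h.[r] != 0.
    have := coprimep_root separable_f rf.
    by rewrite Ef derivM derivXsubC !hornerE subrr mulr0 add0r.
  have [a' Ea] := factor_theorem _ _ (introT eqP a0 : root a r).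
  have := loc (r, 0); rewrite /= -Ey y0 => /(_ erefl)[S [T [T0 E]]].
  (* Since [(x - r) h = y ^+ 2], the element [h (a + b y)] is [y (b h + a' y)], and one factor [y]
     cancels from the local relation. *)
  have E' : ((b * h, a') : chart f) * T = ((0, 1) : chart f) * S.
    have yreg : ((0, 1) : chart f) != 0 by rewrite -pair_eqE /= oner_eq0 andbF.
    apply: (chart_mulfI size_f yreg).
    transitivity (of_poly f h * (((a, b) : chart f) * T)).
      rewrite Ea !mulrA; congr (_ * _); congr pair; rewrite /= ?Ef; ring.
    rewrite E !mulrA; congr (_ * _); congr pair; rewrite /= ?Ef; ring.
  have := congr1 (fun H : chart f => reg_eval H (r, 0)) E'.
  have e1 : reg_eval ((b * h, a') : chart f) (r, 0) = b.[r] * h.[r].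
    by rewrite /reg_eval /= hornerM mulr0 addr0.
  have e2 : reg_eval ((0, 1) : chart f) (r, 0) = 0.
    by rewrite /reg_eval /= horner0 mulr0 addr0.
  rewrite !evalM /= -?Ey ?y0 // e1 e2 mul0r.
  by move/eqP; rewrite !mulf_eq0 (negPf h0) (negPf T0) !orbF rootE.
move=> E1; have := ev0 (- y); rewrite sqrrN => /(_ Ey) E2.
have /eqP : 2 * y * b.[r] = 0.
  by rewrite -[RHS](subrr 0) -{1}E1 -E2; ring.
rewrite !mulf_eq0 (negPf two_neq0) (negPf y0) /= => b0.
by split=> //; move/eqP: E1; rewrite (eqP b0) mul0r addr0.
Qed.

Lemma dvd_local (n : {poly k}) G : n != 0 ->
  (forall p : k * k, p.2 ^+ 2 = f.[p.1] ->
    exists S T : chart f, reg_eval T p != 0 /\ G * T = of_poly f n * S) ->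
  exists H, G = of_poly f n * H.
Proof.
have [m] := ubnP (size n); elim: m n G => // m IHm n G lt_n n0 loc.
have [s1|] := eqVneq (size n) 1%N.
  have [c c0 ->] := size_poly1P n (introT eqP s1).
  exists (of_poly f (c^-1)%:P * G).
  by rewrite mulrA -of_polyM -polyCM mulfV // mul1r.
case/closed_rootP=> r /factor_theorem[n' En]; rewrite {}En in lt_n n0 loc *.
have n'0 : n' != 0 by apply: contraNneq n0 => ->; rewrite mul0r.
have l0 : of_poly f ('X - r%:P) != 0 by rewrite of_poly_neq0 polyXsubC_eq0.
have [|G1 EG] := @dvd_local_linear r G.
  move=> p /loc[S [T [T0 E]]]; exists (of_poly f n' * S), T; split=> //.
  by rewrite E of_polyM; ring.
have [|||H EH] := IHm n' G1.
- by move: lt_n; rewrite size_mul ?polyXsubC_eq0 // size_XsubC addn2.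
- exact: n'0.
- move=> p /loc[S [T [T0 E]]]; exists S, T; split=> //.
  apply: (chart_mulfI size_f l0); rewrite mulrA -EG E of_polyM; ring.
by exists H; rewrite EG EH of_polyM; ring.
Qed.

(** Divisors are taken as integer functions on points, and forms are replaced by elements of the
    affine ring. The order of [G / H] at infinity is then a difference of pole orders. *)
Definition princ c : Prop := exists G H,
  [/\ G != 0, H != 0,
      forall p, exists m n, [/\ vanishing_order f (val p) G m,
        vanishing_order f (val p) H n & c (Some p) = m%:Z - n%:Z]
    & c None = (pole H)%:Z - (pole G)%:Z].

Lemma principal_princ (D : {freeg (point f)}) :
  principal g D <-> princ (fun Q => coeff Q D).
Proof.
split=> [[d [G [H [fG fH G0 H0 ord]]]]|[G [H [G0 H0 ord oinf]]]].
  exists G, H; split=> // [p|]; first exact: (ord (Some p)).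
  have [m [n [om on ->]]] := ord None.
  have [m' om' Em] := form_order_infty size_f fG G0.
  have [n' on' En] := form_order_infty size_f fH H0.
  have Om := @vanishing_order_uniq _ _ _ (infty_on_curve size_f)
    (reverse_neq0 size_f) _ _ _ om om'.
  have On := @vanishing_order_uniq _ _ _ (infty_on_curve size_f)
    (reverse_neq0 size_f) _ _ _ on on'.
  by rewrite Om On; lia.
(* Any weight large enough for both [G] and [H] will do, since it cancels in the quotient. *)
pose d := (size G.1 + size G.2 + size H.1 + size H.2 + g)%N.
have fG : Defs.form g d G.
  by rewrite /Defs.form /d; move: (size G.1) (size G.2) (size H.1) (size H.2); lia.
have fH : Defs.form g d H.
  by rewrite /Defs.form /d; move: (size G.1) (size G.2) (size H.1) (size H.2); lia.
exists d, G, H; split=> // -[p|]; first exact: ord.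
have [m' om' Em] := form_order_infty size_f fG G0.
have [n' on' En] := form_order_infty size_f fH H0.
by exists m', n'; split=> //; rewrite oinf; lia.
Qed.

Lemma eq_princ c1 c2 : c1 =1 c2 -> princ c1 -> princ c2.
Proof.
move=> E [G [H [G0 H0 ord oinf]]]; exists G, H; split; rewrite -?E // => p.
by rewrite -E.
Qed.

Let on_curve (p : {p : k * k | p.2 ^+ 2 == f.[p.1]}) : (val p).2 ^+ 2 = f.[(val p).1].
Proof. exact: (eqP (valP p)). Qed.

Lemma princD c1 c2 : princ c1 -> princ c2 -> princ (fun Q => c1 Q + c2 Q).
Proof.
move=> [G1 [H1 [G10 H10 ord1 o1]]] [G2 [H2 [G20 H20 ord2 o2]]].
exists (G1 * G2), (H1 * H2).
split; [apply: (chart_mulf_neq0 size_f)|apply: (chart_mulf_neq0 size_f)| |] => //.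
  move=> p; have [m1 [n1 [om1 on1 ->]]] := ord1 p.
  have [m2 [n2 [om2 on2 ->]]] := ord2 p.
  exists (m1 + m2)%N, (n1 + n2)%N; split; last by lia.
    exact: (vanishing_orderM (on_curve p)).
  exact: (vanishing_orderM (on_curve p)).
by rewrite o1 o2 !(poleM size_f) //; lia.
Qed.

Lemma princN c : princ c -> princ (fun Q => - c Q).
Proof.
move=> [G [H [G0 H0 ord oinf]]]; exists H, G; split=> // [p|]; last by lia.
by have [m [n [om on ->]]] := ord p; exists n, m; split=> //; lia.
Qed.

Lemma princ0 : princ (fun=> 0).
Proof.
have one0 : (1 : chart f) != 0 by apply: oner_neq0.
exists 1, 1; split=> // [p|]; last by rewrite subrr.
by exists 0%N, 0%N; split=> //; apply: vanishing_order0; rewrite eval1 oner_eq0.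
Qed.

Lemma princZ (z : int) c : princ c -> princ (fun Q => z * c Q).
Proof.
move=> pc; have pn (n : nat) : princ (fun Q => n%:Z * c Q).
  elim: n => [|n IHn]; first by apply: eq_princ princ0 => Q; rewrite mul0r.
  by apply: eq_princ (princD IHn pc) => Q; rewrite -addn1 PoszD mulrDl mul1r.
case: z => n; first exact: pn.
by apply: eq_princ (princN (pn n.+1)) => Q; rewrite NegzE mulNr.
Qed.

(** A function without affine poles is regular: [G / H] equals [G * conj H] over the polynomial
    [norm H], and divisibility by a polynomial is checked locally. *)
Lemma princ_effective c : princ c -> (forall p, 0 <= c (Some p)) ->
  exists G, (pole G)%:Z = - c None /\
    forall p, (reg_eval G (val p) == 0) = (c (Some p) != 0).
Proof.
move=> [G [H [G0 H0 ord oinf]]] c_ge0.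
have [||M EM] := @dvd_local (norm H) (G * conj H).
- by rewrite (norm_eq0 size_f).
- move=> p Ep.
  pose p' := exist (fun q : k * k => q.2 ^+ 2 == f.[q.1]) p (introT eqP Ep).
  have [m [n [om on E]]] := ord p'.
  have le_nm : (n <= m)%N by have := c_ge0 p'; rewrite E; lia.
  have [S [T [T0 ES]]] := vanishing_order_dvd Ep om on le_nm.
  exists S, T; split=> //; rewrite mulrAC ES -mul_conj; ring.
have cH0 : conj H != 0 by rewrite -(norm_eq0 size_f) norm_conj (norm_eq0 size_f).
have EG : G = H * M.
  apply: (chart_mulfI size_f cH0); rewrite mulrC EM -mul_conj; ring.
have M0 : M != 0 by apply: contraNneq G0 => M0; rewrite EG M0 mulr0.
exists M; split; first by rewrite oinf EG (poleM size_f) //; lia.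
move=> p; have [m [n [om on E]]] := ord p.
have le_nm : (n <= m)%N by have := c_ge0 p; rewrite E; lia.
rewrite EG in om.
by rewrite (vanishing_order_quotient (on_curve p) f0 om on le_nm) E; lia.
Qed.

(** * Relations between two points *)

Notation affine := {p : k * k | p.2 ^+ 2 == f.[p.1]}.
Implicit Types P Q : affine.

Let delta (Q R : point f) : int := (R == Q)%:R.

Let opposite_subproof P : (- (val P).2) ^+ 2 == f.[(val P).1].
Proof. by rewrite sqrrN on_curve. Qed.

Definition opposite P : affine :=
  exist (fun q : k * k => q.2 ^+ 2 == f.[q.1])
    ((val P).1, - (val P).2) (opposite_subproof P).

Lemma eval_opposite G P : reg_eval G (val (opposite P)) = reg_eval (conj G) (val P).
Proof. by rewrite /reg_eval /= hornerN mulrN mulNr. Qed.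

Lemma same_abscissa P Q : (val P).1 = (val Q).1 -> P = Q \/ P = opposite Q.
Proof.
case: P Q => [[x y] /= Ey] [[x' y'] /= Ey'] /= Ex; rewrite {x}Ex in Ey *.
have : y ^+ 2 == y' ^+ 2 by rewrite (eqP Ey) (eqP Ey').
rewrite eqf_sqr => /orP[] /eqP E; last by right; apply: val_inj; rewrite /= E.
by left; apply: val_inj; rewrite /= E.
Qed.

Lemma opposite_neq P : (val P).2 != 0 -> P != opposite P.
Proof.
move=> y0; apply/eqP => /(congr1 val)/(congr1 snd) /= /eqP.
by rewrite -subr_eq0 opprK -mulr2n -mulr_natl mulf_eq0 (negPf two_neq0) (negPf y0).
Qed.

(** The function is [x - x(P)], a uniformizer at both points because [P] is not a ramification
    point. *)
Lemma princ_vertical P : (val P).2 != 0 ->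
  princ (fun R => delta (Some P) R + delta (Some (opposite P)) R - 2 * delta None R).
Proof.
move=> y0; have neq := opposite_neq y0.
have l0 : of_poly f ('X - ((val P).1)%:P) != 0 by rewrite of_poly_neq0 polyXsubC_eq0.
exists (of_poly f ('X - ((val P).1)%:P)), 1; split; rewrite ?oner_neq0 //.
  move=> R.
  have one : reg_eval (1 : chart f) (val R) != 0 by rewrite eval1 oner_eq0.
  have uni : (val R).1 = (val P).1 ->
      vanishing_order f (val R) (of_poly f ('X - ((val P).1)%:P)) 1.
    move=> Ex; apply/vanishing_orderP; exists 1, 1; split=> //.
    congr (_ * _); rewrite expr1 /uniformizer Ex; case: eqP => // Ry0.
    by case: (same_abscissa Ex) Ry0 => -> /eqP; rewrite ?oppr_eq0 (negPf y0).
  have [Ex|nx] := eqVneq (val R).1 (val P).1.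
    exists 1%N, 0%N; split; [exact: uni|exact: vanishing_order0|].
    rewrite /delta /= !(inj_eq Some_inj); case: (same_abscissa Ex) => ->.
      by rewrite eqxx (negPf neq).
    by rewrite eqxx eq_sym (negPf neq).
  exists 0%N, 0%N; split; [|exact: vanishing_order0|].
    by apply: vanishing_order0; rewrite eval_of_poly !hornerE subr_eq0.
  rewrite /delta /= !(inj_eq Some_inj).
  have [ERP|_] := eqVneq R P; first by rewrite ERP eqxx in nx.
  by have [ERP|//] := eqVneq R (opposite P); rewrite ERP eqxx in nx.
have norm1 : norm (1 : chart f) = 1 := normX 1 0.
by rewrite /delta /pole norm_of_poly norm1 size_exp_XsubC size_poly1.
Qed.

(** Vertical lines turn negative multiples of a point into positive multiples of its opposite. The
    resulting function has only a pole at infinity, of order at most [2g], so it is a polynomial in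
    [x]. It vanishes at [P] if and only if it vanishes at the opposite point, whereas a nonzero [u]
    would put a zero at exactly one of them. *)
Lemma princ_small P Q (u v : int) :
  (val P).2 != 0 -> (val Q).2 != 0 -> (val P).1 != (val Q).1 ->
  `|u| + `|v| <= (2 * g)%:Z ->
  princ (fun R => u * delta (Some P) R + v * delta (Some Q) R
                  - (u + v) * delta None R) ->
  u = 0 /\ v = 0.
Proof.
move=> yP yQ xPQ small pr.
(* The negative parts of [u] and [v]: the number of vertical lines to add. *)
pose um : int := if u < 0 then - u else 0; pose vm : int := if v < 0 then - v else 0.
have um0 : 0 <= um by rewrite /um; case: ltP => //; lia.
have upm : 0 <= u + um by rewrite /um; case: ltP => //; lia.
have uabs : u + um + um = `|u| by rewrite /um; case: ltP => //; lia.
have uu : ((u + um != 0) = (um != 0)) -> u = 0 by rewrite /um; case: ltP => //; lia.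
have vm0 : 0 <= vm by rewrite /vm; case: ltP => //; lia.
have vpm : 0 <= v + vm by rewrite /vm; case: ltP => //; lia.
have vabs : v + vm + vm = `|v| by rewrite /vm; case: ltP => //; lia.
have vv : ((v + vm != 0) = (vm != 0)) -> v = 0 by rewrite /vm; case: ltP => //; lia.
move: (um) (vm) um0 upm uabs uu vm0 vpm vabs vv.
move=> {}um {}vm um0 upm uabs uu vm0 vpm vabs vv.
pose c R := (u + um) * delta (Some P) R + um * delta (Some (opposite P)) R
  + (v + vm) * delta (Some Q) R + vm * delta (Some (opposite Q)) R
  - (`|u| + `|v|) * delta None R.
have prc : princ c.
  apply: eq_princ (princD pr
    (princD (princZ um (princ_vertical yP)) (princZ vm (princ_vertical yQ)))) => R.
  rewrite /c -uabs -vabs; move: (delta (Some P) R) (delta (Some (opposite P)) R).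
  move: (delta (Some Q) R) (delta (Some (opposite Q)) R) (delta None R) => *.
  by ring.
have [|G [poleG vanG]] := princ_effective prc.
  move=> R; rewrite /c /delta /= mulr0 subr0.
  by rewrite !addr_ge0 // mulr_ge0 // ler0n.
have G2 : G.2 = 0.
  apply: (pole_small size_f); move: poleG small; rewrite /c /delta /= !mulr0 mulr1.
  by rewrite !addr0 add0r opprK => <-.
have same R : (reg_eval G (val R) == 0) = (reg_eval G (val (opposite R)) == 0).
  by rewrite eval_opposite /reg_eval /= G2 oppr0.
have neqP := opposite_neq yP; have neqQ := opposite_neq yQ.
have PQ (R R' : affine) : (val R).1 = (val P).1 -> (val R').1 = (val Q).1 -> R != R'.
  by move=> E1 E2; apply: contraNneq xPQ => E; rewrite -E1 -E2 E.
have cP : c (Some P) = u + um.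
  rewrite /c /delta /= !(inj_eq Some_inj) eqxx (negPf neqP) !(negPf (PQ _ _ _ _)) //.
  by rewrite !mulr0 !addr0 mulr1.
have cP' : c (Some (opposite P)) = um.
  rewrite /c /delta /= !(inj_eq Some_inj) eqxx eq_sym (negPf neqP).
  by rewrite !(negPf (PQ _ _ _ _)) // !mulr0 !addr0 add0r mulr1.
have cQ : c (Some Q) = v + vm.
  rewrite /c /delta /= !(inj_eq Some_inj) eqxx (negPf neqQ) !(eq_sym Q).
  by rewrite !(negPf (PQ _ _ _ _)) // !mulr0 !addr0 !add0r mulr1.
have cQ' : c (Some (opposite Q)) = vm.
  rewrite /c /delta /= !(inj_eq Some_inj) eqxx !(eq_sym (opposite Q)) (negPf neqQ).
  by rewrite !(negPf (PQ _ _ _ _)) // !mulr0 !addr0 !add0r mulr1.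
split; [apply: uu|apply: vv].
  by rewrite -{1}cP -cP' -!vanG same.
by rewrite -{1}cQ -cQ' -!vanG same.
Qed.

(** All affine zeros of [G] lie above the two roots of its norm. As [conj G] does not vanish at [P]
    and [Q], the opposite points are not zeros of [G], and [P] and [Q] take the full multiplicities
    of the norm. *)
Lemma princ_norm P Q (m n : nat) (c : k) G : c != 0 ->
  (val P).2 != 0 -> (val Q).2 != 0 -> (val P).1 != (val Q).1 ->
  norm G = c *: (('X - ((val P).1)%:P) ^+ m * ('X - ((val Q).1)%:P) ^+ n) ->
  reg_eval G (val P) = 0 -> reg_eval (conj G) (val P) != 0 ->
  reg_eval G (val Q) = 0 -> reg_eval (conj G) (val Q) != 0 ->
  princ (fun R => m%:Z * delta (Some P) R + n%:Z * delta (Some Q) R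
                  - (m + n)%:Z * delta None R).
Proof.
move=> c0 yP yQ xPQ nG GP GP' GQ GQ'.
have PQ : P != Q by apply: contraNneq xPQ => ->.
have nG0 : norm G != 0.
  by rewrite nG scaler_eq0 (negPf c0) mulf_eq0 !expf_eq0 !polyXsubC_eq0 !andbF.
have G0 : G != 0 by rewrite -(norm_eq0 size_f).
exists G, 1; split; rewrite ?oner_neq0 //.
  move=> R.
  have o1 : vanishing_order f (val R) (1 : chart f) 0.
    by apply: vanishing_order0; rewrite eval1 oner_eq0.
  suff [l [ol El]] : exists l, vanishing_order f (val R) G l /\
      l%:Z = m%:Z * delta (Some P) (Some R) + n%:Z * delta (Some Q) (Some R).
    by exists l, 0%N; split=> //; rewrite El /delta /= mulr0 !subr0.
  rewrite /delta /= !(inj_eq Some_inj).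
  have local (x : k) l (h : {poly k}) : (val R).1 = x -> (val R).2 != 0 ->
      norm G = ('X - x%:P) ^+ l * h -> h.[x] != 0 ->
      reg_eval (conj G) (val R) != 0 -> vanishing_order f (val R) G l.
    move=> xR yR E h0 cG; apply/vanishing_orderP.
    exists (of_poly f h), (conj G); split=> //; first by rewrite eval_of_poly xR.
    by rewrite mul_conj E of_polyM of_polyX /uniformizer (negPf yR) xR.
  have [ERP|nP] := eqVneq R P.
    rewrite ERP in local *; exists m; rewrite (negPf PQ) mulr0 addr0 mulr1; split=> //.
    apply: (local (val P).1 m (c *: ('X - ((val Q).1)%:P) ^+ n)) => //.
      by rewrite nG scalerAr.
    by rewrite !hornerE mulf_neq0 // expf_neq0 // subr_eq0.
  have [ERQ|nQ] := eqVneq R Q.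
    rewrite ERQ in local *; exists n; rewrite mulr0 add0r mulr1; split=> //.
    apply: (local (val Q).1 n (c *: ('X - ((val P).1)%:P) ^+ m)) => //.
      by rewrite nG mulrC scalerAr.
    by rewrite !hornerE mulf_neq0 // expf_neq0 // subr_eq0 eq_sym.
  exists 0%N; rewrite !mulr0; split=> //; apply: vanishing_order0.
  apply/eqP => GR; have := eval_norm (on_curve R) GR; rewrite nG !hornerE => /eqP.
  have nxP : (val R).1 != (val P).1.
    apply/eqP => /same_abscissa[E|E]; first by rewrite E eqxx in nP.
    by move: GP'; rewrite -eval_opposite -E GR eqxx.
  have nxQ : (val R).1 != (val Q).1.
    apply/eqP => /same_abscissa[E|E]; first by rewrite E eqxx in nQ.
    by move: GQ'; rewrite -eval_opposite -E GR eqxx.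
  by rewrite !mulf_eq0 (negPf c0) !expf_eq0 !subr_eq0 (negPf nxP) (negPf nxQ) !andbF.
have norm1 : norm (1 : chart f) = 1 := normX 1 0.
rewrite /delta /pole norm1 size_poly1 nG size_scale //= !mulr0 !add0r mulr1.
by rewrite size_mul ?expf_neq0 ?polyXsubC_eq0 // !size_exp_XsubC addnS.
Qed.

(** Sum and difference of the coordinates of a point of the l1-ball of radius [g] have the same
    parity. The parity of [g] gives the [(g + 1)^2] points of the first summand, the other parity
    the [g^2] points of the second. *)
Let ball_coords (x : 'I_g.+1 * 'I_g.+1 + 'I_g * 'I_g) : int * int :=
  match x with
  | inl (i, j) => ((i + j)%:Z - g%:Z, i%:Z - j%:Z)
  | inr (i, j) => ((i + j).+1%:Z - g%:Z, i%:Z - j%:Z)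
  end.

Let ball_coords_inj : injective ball_coords.
Proof.
move=> [[i j]|[i j]] [[i' j']|[i' j']] /= [E1 E2]; try lia.
  have -> : i = i' by apply: val_inj => /=; lia.
  by have -> : j = j' by apply: val_inj => /=; lia.
have -> : i = i' by apply: val_inj => /=; lia.
by have -> : j = j' by apply: val_inj => /=; lia.
Qed.

Let ball_coords_diff x y :
  `|(ball_coords x).1 - (ball_coords y).1| + `|(ball_coords x).2 - (ball_coords y).2|
    <= (2 * g)%:Z.
Proof.
case: x y => [[i j]|[i j]] [[i' j']|[i' j']] /=;
  have := ltn_ord i; have := ltn_ord j; have := ltn_ord i'; have := ltn_ord j'; lia.
Qed.

(* The l1-ball of radius [g] in [Z^2] has [2g^2 + 2g + 1] points. By [princ_small]
   their classes [u P + v Q] are distinct multiples of [P], so the order of [P]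
   is at least that large; being a divisor of [N < 2 (2g^2 + 2g + 1)], it is [N]. *)
Theorem class_order_two_functions P Q (a b N : nat) (c1 c2 : k) (G1 G2 : chart f) :
  (val P).2 != 0 -> (val Q).2 != 0 -> (val P).1 != (val Q).1 ->
  c1 != 0 -> c2 != 0 ->
  norm G1 = c1 *: (('X - ((val P).1)%:P) ^+ a * ('X - ((val Q).1)%:P)) ->
  norm G2 = c2 *: (('X - ((val P).1)%:P) ^+ 2 * ('X - ((val Q).1)%:P) ^+ b) ->
  reg_eval G1 (val P) = 0 -> reg_eval (conj G1) (val P) != 0 ->
  reg_eval G1 (val Q) = 0 -> reg_eval (conj G1) (val Q) != 0 ->
  reg_eval G2 (val P) = 0 -> reg_eval (conj G2) (val P) != 0 ->
  reg_eval G2 (val Q) = 0 -> reg_eval (conj G2) (val Q) != 0 ->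
  (0 < N)%N -> (a * b = N + 2)%N -> (N < 2 * (2 * g ^ 2 + 2 * g + 1))%N ->
  class_order g (<< (Some P : point f) >> - << infty >>) N.
Proof.
move=> yP yQ xPQ c10 c20 nG1 nG2 G1P G1P' G1Q G1Q' G2P G2P' G2Q G2Q' N0 EN ltN.
have pr1 := princ_norm (n := 1) c10 yP yQ xPQ nG1 G1P G1P' G1Q G1Q'.
have pr2 := princ_norm c20 yP yQ xPQ nG2 G2P G2P' G2Q G2Q'.
pose dP R := delta (Some P) R - delta None R.
have coefP m R : coeff R ((<< (Some P : point f) >> - << infty >>) *+ m) = m%:Z * dP R.
  have cU (S : point f) : coeff R (<< S >> : {freeg (point f)}) = delta S R.
    by rewrite coeffU mul1r eq_sym.
  by rewrite coeffMn coeffB !cU -/(dP R) -[LHS]mulr_natl natz.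
(* [b (a P + Q) - (2 P + b Q) = (a b - 2) P]. *)
have prN : princ (fun R => N%:Z * dP R).
  apply: eq_princ (princD (princZ b%:Z pr1) (princN pr2)) => R.
  have EN' : N%:Z = a%:Z * b%:Z - 2 by rewrite -PoszM EN PoszD addrK.
  rewrite /dP EN' !PoszD.
  by move: (delta _ R) (delta _ R) (delta None R) => *; ring.
split=> //.
  by apply/principal_princ; apply: eq_princ prN => R; rewrite coefP.
move=> m m0 /principal_princ prm; rewrite leqNgt; apply/negP => lt_mN.
have {}prm : princ (fun R => m%:Z * dP R).
  by apply: eq_princ prm => R; rewrite coefP.
(* By Bezout [d] also kills the class. It is a proper divisor of [N], so it is at most [N / 2], less
   than the number of points of the ball. *)
pose d := gcdn m N.
have d0 : (0 < d)%N by rewrite gcdn_gt0 m0.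
have prd : princ (fun R => d%:Z * dP R).
  have [x [y Exy]] := Bezoutz m N.
  apply: eq_princ (princD (princZ x prm) (princZ y prN)) => R.
  by rewrite !mulrA -mulrDl Exy.
have lt_d : (d < 2 * g ^ 2 + 2 * g + 1)%N.
  have dm : (d <= m)%N by apply: dvdn_leq (dvdn_gcdl _ _).
  have /dvdnP[q Eq] : (d %| N)%N by apply: dvdn_gcdr.
  have q1 : (1 < q)%N.
    rewrite ltnNge; apply/negP => q1; move: lt_mN; rewrite ltnNge => /negP; apply.
    by rewrite Eq (leq_trans _ dm) // -{2}[d]mul1n leq_mul2r q1 orbT.
  rewrite -(ltn_pmul2l (isT : 0 < 2)%N); apply: leq_ltn_trans ltN.
  by rewrite Eq leq_mul2r q1 orbT.
(* As [Q = - a P], the class of [u P + v Q] is [(u - a v) P], which depends only on this residue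
   modulo [d]. By the pigeonhole principle two points of the ball share a residue. *)
pose phi x : 'I_d.-1.+1 :=
  inord `|(((ball_coords x).1 - a%:Z * (ball_coords x).2) %% d)%Z|%N.
have /injectivePn[x [y neq_xy Exy]] : ~~ injectiveb phi.
  apply/negP => /injectiveP/leq_card; rewrite card_sum !card_prod !card_ord.
  rewrite prednK // leqNgt; move/negP; apply.
  by have -> : (g.+1 * g.+1 + g * g = 2 * g ^ 2 + 2 * g + 1)%N by ring.
have [z Ez] : exists z, ((ball_coords x).1 - a%:Z * (ball_coords x).2)
    - ((ball_coords y).1 - a%:Z * (ball_coords y).2) = z * d%:Z.
  apply/dvdzP; rewrite -eqz_mod_dvd; apply/eqP.
  have dz : d%:Z != 0 by rewrite eqz_nat -lt0n.
  have ge0 t : (0 <= t %% d)%Z := modz_ge0 t dz.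
  have lt t : (`|(t %% d)%Z| < d.-1.+1)%N.
    by rewrite prednK // -ltz_nat gez0_abs // ltz_pmod.
  move/(congr1 val): Exy; rewrite /phi /= !inordK // => E.
  by rewrite -[LHS]gez0_abs // -[RHS]gez0_abs // E.
pose u := (ball_coords x).1 - (ball_coords y).1.
pose v := (ball_coords x).2 - (ball_coords y).2.
have [||u0 v0] := @princ_small P Q u v yP yQ xPQ.
- exact: ball_coords_diff.
- apply: eq_princ (princD (princZ z prd) (princZ v pr1)) => R.
  (* Hence [u P + v Q = z (d P) + v (a P + Q)]. *)
  have Eu : u = z * d%:Z + a%:Z * v by rewrite -Ez /u /v; ring.
  rewrite /dP mulrA Eu PoszD.
  by move: (delta _ R) (delta _ R) (delta None R) => *; ring.
case/negP: neq_xy; apply/eqP/ball_coords_inj.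
move: u0 v0; rewrite /u /v; case: (ball_coords x) (ball_coords y) => [x1 x2] [y1 y2] /=.
by move=> /eqP; rewrite subr_eq0 => /eqP-> /eqP; rewrite subr_eq0 => /eqP->.
Qed.

End ClosedCurve.

(** * Double roots of the polynomials of the two families *)

(* At a root [x], [u] and [v] stand for the values of [U] and [V], [du] and [dv]
   for those of their derivatives, and [T], [dT] for those of the polynomial
   [T = t x^2 (x - 1)] (resp. [s x (x - 1)^2]) and its derivative. The proofs use
   [(x - g)^2 f = (1 - T) (S^2 - T D^2)] with [S = U + V] and [D = U - V]. *)
Section DoubleRoot.

Variables (L : fieldType) (g x w z T dT : L).
Hypothesis two_neq0 : (2 : L) != 0.

Let u := (x - g) * x * w.
Let du := x * w + (g - 1) * (x - g) * w.
Let v := (x - 1) ^+ 2 * z.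
Let dv := g * (x - 1) * z.
Let S := u + v.
Let D := u - v.
Let dS := du + dv.
Let dD := du - dv.

Hypotheses (x0 : x != 0) (x1 : x - 1 != 0) (xg : x - g != 0).
Hypotheses (w0 : w != 0) (z0 : z != 0).
Hypothesis root1 : (1 - T) * (S ^+ 2 - T * D ^+ 2) = 0.
Hypothesis root2 : - dT * (S ^+ 2 - T * D ^+ 2)
  + (1 - T) * (2 * S * dS - dT * D ^+ 2 - 2 * T * D * dD) = 0.
Hypothesis simple : T = 1 -> dT != 0.

Let u0 : u != 0. Proof. by rewrite !mulf_neq0. Qed.
Let v0 : v != 0. Proof. by rewrite !mulf_neq0 // expf_neq0. Qed.

(** For [T = 1] the second equation reduces to [dT * (S^2 - D^2) = 0], and [S^2 - D^2 = 4 u v] is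
    nonzero. *)
Let T1 : 1 - T != 0.
Proof.
apply/eqP => T1; have ET : T = 1 by apply/eqP; rewrite eq_sym -subr_eq0 T1.
have /eqP : dT * (2 * 2 * u * v) = 0.
  by move: root2; rewrite T1 mul0r addr0 ET => /eqP; rewrite mulNr oppr_eq0;
    move/eqP <-; rewrite /S /D; ring.
by apply/negP; rewrite !mulf_neq0 ?expf_neq0 // simple.
Qed.

Let E1 : S ^+ 2 = T * D ^+ 2.
Proof.
by move/eqP: root1; rewrite mulf_eq0 (negPf T1) /= subr_eq0 => /eqP.
Qed.

Let E2 : 2 * S * dS = dT * D ^+ 2 + 2 * T * D * dD.
Proof.
move/eqP: root2; rewrite E1 subrr mulr0 add0r mulf_eq0 (negPf T1) /=.
by rewrite -addrA -opprD subr_eq0 => /eqP.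
Qed.

Let D0 : D != 0.
Proof.
apply/eqP => D0; have /eqP := E1; rewrite D0 expr0n /= mulr0 sqrf_eq0 => /eqP S0.
have /eqP : 2 * u = 0 by rewrite -[RHS](addr0 0) -{1}S0 -D0 /S /D; ring.
by apply/negP; rewrite mulf_neq0.
Qed.

(** Differentiating [S^2 = T D^2] and eliminating gives [2 T (D S' - D' S) = T' D S]. Here
    [D S' - D' S] is twice the Wronskian [u dv - v du], which collapses to
    [- g (g - 1) (x - 1) w z]. *)
Lemma double_root_wronskian :
  - (2 * 2) * T * g * (g - 1) * w * z * (x - 1) = dT * D * S.
Proof.
have -> : - (2 * 2) * T * g * (g - 1) * w * z * (x - 1) = 2 * T * (D * dS - dD * S).
  by rewrite /S /D /dS /dD /u /v /du /dv; ring.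
apply: (mulfI D0); apply/eqP; rewrite -subr_eq0; apply/eqP.
transitivity (2 * dS * (T * D ^+ 2) - S * (dT * D ^+ 2 + 2 * T * D * dD)); first ring.
by rewrite -E1 -E2; ring.
Qed.

(** Since [4 u v = S^2 - D^2 = - (1 - T) D^2], the Wronskian identity is linear in [D] and [S] after
    division by [D]. The normalization of [t] gives [g^2 (g - 1) (1 - T) = - (x - g) q], whence
    [q D + g (3 x - 2) S = 0]. This relation yields the trinomial, and its square, with
    [S^2 = T D^2], the quartic; a factor [x - g] is removed from each. *)
Lemma double_root_t (t : L) : t * (g ^+ 2 * (g - 1)) = 1 ->
  T = t * (x ^+ 2 * (x - 1)) -> dT = t * (x * (3 * x - 2)) ->
  9 * x ^+ 4 + (8 * g - 20) * x ^+ 3 + (6 * g ^+ 2 - 16 * g + 14) * x ^+ 2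
    + 3 * (g - 1) ^+ 3 * x + g * (g - 1) ^+ 3 = 0 /\
  x * w * (x ^+ 2 + (4 * g - 1) * x + g ^+ 2 - 3 * g)
    - (x - 1) ^+ 2 * z * (x - g - 1) = 0.
Proof.
move=> tg ET EdT.
have t0 : t != 0 by apply: contra_eqN tg => /eqP->; rewrite mul0r eq_sym oner_eq0.
pose q := x ^+ 2 + (g - 1) * x + g * (g - 1).
have E3 : - (2 * 2) * g * (g - 1) * u * v = (3 * x - 2) * (x - g) * D * S.
  apply: (mulfI (mulf_neq0 t0 x0)).
  transitivity ((x - g) * (dT * D * S)); last by rewrite EdT; ring.
  by rewrite -double_root_wronskian ET /u /v; ring.
have E4 : g * (g - 1) * (1 - T) * D = (3 * x - 2) * (x - g) * S.
  apply: (mulfI D0); transitivity ((3 * x - 2) * (x - g) * D * S); last ring.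
  rewrite -E3; transitivity (g * (g - 1) * (D ^+ 2 - T * D ^+ 2)); first ring.
  by rewrite -E1 /S /D; ring.
have E5 : q * D + g * (3 * x - 2) * S = 0.
  apply: (mulfI xg); rewrite mulr0.
  transitivity ((x - g) * q * D + g * ((3 * x - 2) * (x - g) * S)); first ring.
  rewrite -E4.
  transitivity ((t * (g ^+ 2 * (g - 1)) - 1) * (- x ^+ 2 * (x - 1)) * D).
    by rewrite ET /q; ring.
  by rewrite tg subrr !mul0r.
split; apply: (mulfI xg); rewrite mulr0; last first.
  by rewrite -E5 /q /D /S /u /v; ring.
have E6 : q ^+ 2 = g ^+ 2 * (3 * x - 2) ^+ 2 * T.
  apply: (mulIf (expf_neq0 2 D0)); rewrite -[RHS]mulrA -E1 -!exprMn.
  have -> : q * D = - (g * (3 * x - 2) * S) by apply/eqP; rewrite -addr_eq0 E5.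
  by rewrite sqrrN.
transitivity ((3 * x - 2) ^+ 2 * (x ^+ 2 * (x - 1)) - (g - 1) * q ^+ 2).
  by rewrite /q; ring.
rewrite E6 ET.
transitivity ((1 - t * (g ^+ 2 * (g - 1))) * ((3 * x - 2) ^+ 2 * (x ^+ 2 * (x - 1)))).
  by ring.
by rewrite tg subrr mul0r.
Qed.

(** The same elimination as in [double_root_t], now with [x (x - 1)^2 - g (g - 1)^2 = (x - g) q]. *)
Lemma double_root_s (s : L) : s * (g * (g - 1) ^+ 2) = 1 ->
  T = s * (x * (x - 1) ^+ 2) -> dT = s * ((x - 1) * (3 * x - 1)) ->
  9 * x ^+ 4 + (8 * g - 24) * x ^+ 3 + (6 * g ^+ 2 - 20 * g + 22) * x ^+ 2
    + (3 * (g - 1) ^+ 3 - 3 * (g - 1) ^+ 2 + g - 2) * x + (g - 1) ^+ 4 = 0 /\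
  x * w * (x ^+ 2 + (4 * g - 5) * x + (g - 1) * (g - 2))
    - (x - 1) ^+ 2 * z * (x - g + 1) = 0.
Proof.
move=> sg ET EdT.
have s0 : s != 0 by apply: contra_eqN sg => /eqP->; rewrite mul0r eq_sym oner_eq0.
pose q := x ^+ 2 + (g - 2) * x + (g - 1) ^+ 2.
have E3 : - (2 * 2) * g * (g - 1) * u * v = (3 * x - 1) * (x - g) * D * S.
  apply: (mulfI (mulf_neq0 s0 x1)).
  transitivity ((x - g) * (dT * D * S)); last by rewrite EdT; ring.
  by rewrite -double_root_wronskian ET /u /v; ring.
have E4 : g * (g - 1) * (1 - T) * D = (3 * x - 1) * (x - g) * S.
  apply: (mulfI D0); transitivity ((3 * x - 1) * (x - g) * D * S); last ring.
  rewrite -E3; transitivity (g * (g - 1) * (D ^+ 2 - T * D ^+ 2)); first ring.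
  by rewrite -E1 /S /D; ring.
have E5 : q * D + (g - 1) * (3 * x - 1) * S = 0.
  apply: (mulfI xg); rewrite mulr0.
  transitivity ((x - g) * q * D + (g - 1) * ((3 * x - 1) * (x - g) * S)); first ring.
  rewrite -E4.
  transitivity ((s * (g * (g - 1) ^+ 2) - 1) * (- x * (x - 1) ^+ 2) * D).
    by rewrite ET /q; ring.
  by rewrite sg subrr !mul0r.
split; apply: (mulfI xg); rewrite mulr0; last first.
  by rewrite -E5 /q /D /S /u /v; ring.
have E6 : q ^+ 2 = (g - 1) ^+ 2 * (3 * x - 1) ^+ 2 * T.
  apply: (mulIf (expf_neq0 2 D0)); rewrite -[RHS]mulrA -E1 -!exprMn.
  have -> : q * D = - ((g - 1) * (3 * x - 1) * S) by apply/eqP; rewrite -addr_eq0 E5.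
  by rewrite sqrrN.
transitivity ((3 * x - 1) ^+ 2 * (x * (x - 1) ^+ 2) - g * q ^+ 2).
  by rewrite /q; ring.
rewrite E6 ET.
transitivity ((1 - s * (g * (g - 1) ^+ 2)) * ((3 * x - 1) ^+ 2 * (x * (x - 1) ^+ 2))).
  by ring.
by rewrite sg subrr mul0r.
Qed.

End DoubleRoot.

(** * Common roots of the quartics and the trinomials of the two families *)

(** The quartic of [double_root_s] in terms of [a = g - 1]; negative values of [a] serve the first
    family. *)
Definition quartic (a : int) : {poly int} :=
  9%:P * 'X^4 + (8 * a - 16)%:P * 'X^3 + (6 * a ^+ 2 - 8 * a + 8)%:P * 'X^2
  + (3 * a ^+ 3 - 3 * a ^+ 2 + a - 1)%:P * 'X + (a ^+ 4)%:P.

Definition quartic_dominated (a : int) : bool :=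
  9 + `|8 * a - 16| + `|6 * a ^+ 2 - 8 * a + 8|
    + `|3 * a ^+ 3 - 3 * a ^+ 2 + a - 1| < a ^+ 4.

Local Notation toC := (map_poly (intr : int -> algC)).

Lemma quarticE a (x : algC) : (toC (quartic a)).[x] =
  9 * x ^+ 4 + (8 * a - 16)%:~R * x ^+ 3 + (6 * a ^+ 2 - 8 * a + 8)%:~R * x ^+ 2
  + (3 * a ^+ 3 - 3 * a ^+ 2 + a - 1)%:~R * x + (a ^+ 4)%:~R.
Proof.
have CM c (p : {poly int}) : toC (c%:P * p) = (c%:~R)%:P * toC p.
  by rewrite rmorphM /= map_polyC.
have toCD (p q : {poly int}) : toC (p + q) = toC p + toC q by rewrite rmorphD.
by rewrite /quartic !toCD !CM !map_polyC !map_polyXn map_polyX /= !hornerE.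
Qed.

(** On the closed unit disc the constant term [a^4] exceeds the sum of all other terms in absolute
    value. *)
Lemma quartic_root_gt1 a (x : algC) : quartic_dominated a ->
  root (toC (quartic a)) x -> 1 < `|x|.
Proof.
rewrite /quartic_dominated rootE quarticE addr_eq0 => dom /eqP E.
rewrite real_ltNge ?real1 ?normr_real //; apply/negP => x1.
have bound (c : int) n : `|c%:~R * x ^+ n| <= `|c|%:~R.
  by rewrite normrM normrX intr_norm ler_piMr // exprn_ile1.
have := dom; rewrite -(ltr_int algC) => /lt_geF/negP; apply.
have -> : (a ^+ 4)%:~R = `|(a ^+ 4)%:~R| :> algC.
  by rewrite ger0_norm // ler0z exprn_even_ge0.
rewrite -[`|(a ^+ 4)%:~R|]normrN -E.
have b4 : `|9 * x ^+ 4| <= 9 := bound 9 4%N.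
have b1 := bound (3 * a ^+ 3 - 3 * a ^+ 2 + a - 1) 1%N; rewrite expr1 in b1.
rewrite [leRHS]intrD [X in _ <= X + _]intrD [X in _ <= X + _ + _]intrD.
apply: le_trans (ler_normD _ _) _; apply: lerD => //.
apply: le_trans (ler_normD _ _) _; apply: lerD => //.
by apply: le_trans (ler_normD _ _) _; apply: lerD.
Qed.

(** By Gauss's lemma the primitive gcd divides both polynomials over the integers. Were it constant,
    a Bezout relation would equate a nonzero constant to 0 at [x]. *)
Lemma common_factor (p q : {poly int}) (x : algC) :
  root (toC p) x -> root (toC q) x ->
  exists m p' q' : {poly int}, [/\ p = m * p', q = m * q' & (size m != 1)%N].
Proof.
move=> px qx; exists (zprimitive (gcdp p q)).
have [p' Ep] := dvdpP_int (dvdp_gcdl p q).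
have [q' Eq] := dvdpP_int (dvdp_gcdr p q).
exists p', q'; split=> //; rewrite size_zprimitive; apply/negP => cop.
have /Bezout_coprimepP[[u v]] : coprimep p q by [].
rewrite -size_poly_eq1 => /size_poly1P[c c0 /= E].
move: (congr1 (fun h => (toC h).[x]) E).
rewrite rmorphD !rmorphM /= hornerD !hornerM (eqP px) (eqP qx) !mulr0 addr0.
by rewrite map_polyC hornerC => /esym/eqP; rewrite intr_eq0 (negPf c0).
Qed.

(* [m(0)] divides [a], hence [p(0) = a^4 / m(0)] and so the coefficient of [x] in
   the quartic, which is [-1] modulo [a]. *)
Lemma quartic_factor0 (a c : int) (m p q r : {poly int}) : a != 0 ->
  quartic a = m * p -> r = m * q -> r.[0] = a * c -> coprimez c a ->
  `|m.[0]| = 1.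
Proof.
move=> a0 Ep Eq r0 cop.
have m0r : (m.[0] %| a * c)%Z by rewrite -r0 Eq hornerM dvdz_mulr.
have E0 : m.[0] * p.[0] = a ^+ 4.
  by rewrite -hornerM -Ep /quartic !(hornerD, hornerM, hornerC, hornerXn, hornerX); ring.
have E1 : m^`().[0] * p.[0] + m.[0] * p^`().[0] = 3 * a ^+ 3 - 3 * a ^+ 2 + a - 1.
  rewrite -!hornerM -hornerD -derivM -Ep /quartic.
  rewrite !(derivD, derivM, derivC, derivXn, derivX).
  by rewrite !(hornerD, hornerM, hornerMn, hornerC, hornerXn, hornerX) /=; ring.
have m0a : (m.[0] %| a)%Z.
  have cop4 : coprimez (a ^+ 4) c by apply: coprimezXl; rewrite coprimez_sym.
  rewrite -(@Gauss_dvdzl _ _ c) //; apply: coprimez_dvdl cop4.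
  by rewrite -E0 abszM dvdn_mulr.
have [e Ea] := dvdzP m0a.
have m0 : m.[0] != 0.
  by apply: contraNneq (expf_neq0 4 a0) => m0; rewrite -E0 m0 mul0r.
have p0 : p.[0] = m.[0] * (m.[0] ^+ 2 * e ^+ 4).
  by apply: (mulfI m0); rewrite E0 Ea; ring.
have : (m.[0] %| 1)%Z.
  apply/dvdzP.
  exists (- m^`().[0] * (m.[0] ^+ 2 * e ^+ 4) - p^`().[0] + e * (3 * a ^+ 2 - 3 * a + 1)).
  transitivity (3 * a ^+ 3 - 3 * a ^+ 2 + a - (3 * a ^+ 3 - 3 * a ^+ 2 + a - 1)).
    by ring.
  by rewrite -E1 p0 Ea; ring.
by rewrite dvdz1 => /eqP; rewrite -[`|m.[0]|]abszE => ->.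
Qed.

(** A common root gives a nonconstant integral factor [m] of both polynomials with [|m(0)| = 1]. But
    [|m(0)|] is the product of the leading coefficient, at least 1 in absolute value, and of the
    moduli of roots of the quartic, all greater than 1. *)
Theorem no_common_root (a c : int) (r : {poly int}) (x : algC) :
  a != 0 -> quartic_dominated a -> r.[0] = a * c -> coprimez c a ->
  root (toC (quartic a)) x -> ~~ root (toC r) x.
Proof.
move=> a0 dom r0 cop qx; apply/negP => rx.
have [m [p [q [Ep Eq sm]]]] := common_factor qx rx.
have m1 := quartic_factor0 a0 Ep Eq r0 cop.
have [s Es] := closed_field_poly_normal (toC m).
have mn0 : m != 0.
  by apply: contra_eqN m1 => /eqP->; rewrite horner0 normr0.
have size_m : size (toC m) = size m by apply: size_map_inj_poly; [exact: intr_inj|].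
have toCm0 : toC m != 0 by rewrite -size_poly_eq0 size_m size_poly_eq0.
have lead1 : 1 <= `|lead_coef (toC m)|.
  rewrite lead_coef_map_inj //; last exact: intr_inj.
  by rewrite -intr_norm ler1z -gtz0_ge1 normr_gt0 lead_coef_eq0.
have roots y : y \in s -> 1 < `|y|.
  move=> ys; apply: (quartic_root_gt1 dom); rewrite Ep rmorphM /= rootM Es.
  by rewrite rootZ ?lead_coef_eq0 // root_prod_XsubC ys.
have : `|(toC m).[0]| = 1.
  have := horner_map (intr : {rmorphism int -> algC}) m 0; rewrite /= => ->.
  by rewrite -intr_norm m1.
have prod_ge1 (l : seq algC) : {subset l <= s} ->
    1 <= `|\prod_(z <- l) ('X - z%:P).[0]|.
  elim: l => [|z l IHl] sub; first by rewrite big_nil normr1.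
  rewrite big_cons normrM hornerXsubC sub0r normrN -[leLHS]mulr1.
  apply: ler_pM => //; first by apply/ltW/roots/sub/mem_head.
  by apply: IHl => t tl; apply: sub; rewrite in_cons tl orbT.
rewrite Es hornerZ horner_prod normrM => E.
case: s Es roots prod_ge1 E => [|y s] Es roots prod_ge1.
  by move: sm; rewrite -size_m Es big_nil size_scale ?size_poly1 // lead_coef_eq0.
have y1 := roots y (mem_head _ _).
have s1 : 1 <= `|\prod_(z <- s) ('X - z%:P).[0]|.
  by apply: prod_ge1 => t ts; rewrite in_cons ts orbT.
rewrite big_cons normrM hornerXsubC sub0r normrN; apply/eqP; rewrite gt_eqF //.
apply: lt_le_trans y1 _; rewrite -[leLHS]mul1r; apply: ler_pM => //.
by rewrite -[leLHS]mulr1; apply: ler_pM.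
Qed.

(** * Torsion on curves over the rationals *)

Local Notation QtoC := (map_poly (ratr : rat -> algC)).

Lemma coprimep_of_roots (p q : {poly rat}) : p != 0 ->
  (forall x : algC, root (QtoC p) x -> ~~ root (QtoC q) x) -> coprimep p q.
Proof.
move=> p0 pq; rewrite -(coprimep_map (ratr : {rmorphism rat -> algC})) /coprimep.
apply/negPn/negP => /closed_rootP[x]; rewrite root_gcd => /andP[px].
exact/negP/pq.
Qed.

Lemma hyperelliptic_coprime (g : nat) (f : {poly rat}) :
  size f = (2 * g + 2)%N -> coprimep f f^`() -> hyperelliptic g f.
Proof.
move=> sf cop; split=> // q q1; apply/negP => q2.
have /separable_polyP[sep _] : separable_poly f by rewrite unlock.
by have := sep q q; rewrite -expr2 => /(_ q2); rewrite coprimepp gtn_eqF.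
Qed.

(** Base change of [class_order_two_functions] to [algC]: extension of scalars commutes with norms,
    conjugation and evaluation. *)
Theorem torsion_two_functions (g : nat) (f : {poly rat})
    (P Q : {p : rat * rat | p.2 ^+ 2 == f.[p.1]}) (a b N : nat) (c1 c2 : rat)
    (G1 G2 : chart f) :
  size f = (2 * g + 2)%N -> coprimep f f^`() ->
  (val P).2 != 0 -> (val Q).2 != 0 -> (val P).1 != (val Q).1 ->
  c1 != 0 -> c2 != 0 ->
  norm G1 = c1 *: (('X - ((val P).1)%:P) ^+ a * ('X - ((val Q).1)%:P)) ->
  norm G2 = c2 *: (('X - ((val P).1)%:P) ^+ 2 * ('X - ((val Q).1)%:P) ^+ b) ->
  reg_eval G1 (val P) = 0 -> reg_eval (conj G1) (val P) != 0 ->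
  reg_eval G1 (val Q) = 0 -> reg_eval (conj G1) (val Q) != 0 ->
  reg_eval G2 (val P) = 0 -> reg_eval (conj G2) (val P) != 0 ->
  reg_eval G2 (val Q) = 0 -> reg_eval (conj G2) (val Q) != 0 ->
  (0 < N)%N -> (a * b = N + 2)%N -> (N < 2 * (2 * g ^ 2 + 2 * g + 1))%N ->
  torsion_divisor g (Some P : point f) N.
Proof.
move=> sf cop yP yQ xPQ c10 c20 nG1 nG2 e1 e2 e3 e4 e5 e6 e7 e8 N0 EN ltN.
pose lift (G : chart f) : chart (QtoC f) := (QtoC G.1, QtoC G.2).
have norm_lift G : norm (lift G) = QtoC (norm G).
  by rewrite /norm /= !expr2 rmorphB !rmorphM.
have conj_lift G : conj (lift G) = lift (conj G).
  by rewrite /conj /lift /= rmorphN.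
have eval_lift G x y : reg_eval (lift G) (ratr x, ratr y) = ratr (reg_eval G (x, y)).
  by rewrite /reg_eval /= !horner_map rmorphD rmorphM.
have XsubC x : 'X - (ratr x : algC)%:P = QtoC ('X - x%:P).
  by rewrite rmorphB /= map_polyX map_polyC.
case: P Q => [[xP yP'] Pf] [[xQ yQ'] Qf] /=
  in yP yQ xPQ nG1 nG2 e1 e2 e3 e4 e5 e6 e7 e8 *.
pose mk x y Pxy : {p : algC * algC | p.2 ^+ 2 == (QtoC f).[p.1]} :=
  exist (fun q : algC * algC => q.2 ^+ 2 == (QtoC f).[q.1]) (ratr x, ratr y) Pxy.
have Qf' : (ratr yQ') ^+ 2 == (QtoC f).[ratr xQ].
  by rewrite -rmorphXn horner_map (eqP Qf).
apply: (@class_order_two_functions _ g (QtoC f) _ _ _ _ (mk xQ yQ' Qf') a b N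
  (ratr c1) (ratr c2) (lift G1) (lift G2)) => //=;
  rewrite ?size_map_poly // ?deriv_map ?coprimep_map ?fmorph_eq0 ?pnatr_eq0 //;
  rewrite ?norm_lift ?conj_lift ?eval_lift ?fmorph_eq0 ?(inj_eq (fmorph_inj _)) //.
- by rewrite nG1 map_polyZ rmorphM rmorphXn /= !XsubC.
- by rewrite nG2 map_polyZ rmorphM !rmorphXn /= !XsubC.
- by rewrite e1 rmorph0.
- by rewrite e3 rmorph0.
- by rewrite e5 rmorph0.
- by rewrite e7 rmorph0.
Qed.

(** * Both families at once: [(i, j)] is [(1, 0)] for the first and [(0, 1)] for the second *)

Section Family.

Variables (n i j : nat) (c : rat) (A f : {poly rat}).
Let g := n.+2.
Let U : {poly rat} := ('X - g%:R%:P) * 'X^(n.+1).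
Let V : {poly rat} := ('X - 1) ^+ g.
Let T : {poly rat} := c *: ('X^(i.+1) * ('X - 1) ^+ j.+1).
Let B : {poly rat} := U + V - T * (U - V).

Hypothesis ij : (i + j)%N = 1%N.
Hypothesis c0 : c != 0.
Hypothesis AE : A * ('X - g%:R%:P) = U + V + T * (U - V).
Hypothesis fE :
  f = A ^+ 2 - (4 * c) *: ('X^(n.+1.*2 + i.+1) * ('X - 1) ^+ j.+1).

Let Xg0 : 'X - g%:R%:P != 0 :> {poly rat}.
Proof. by rewrite polyXsubC_eq0. Qed.

Let TU : T * U ^+ 2 =
  ('X - g%:R%:P) ^+ 2 * (c *: ('X^(n.+1.*2 + i.+1) * ('X - 1) ^+ j.+1)).
Proof.
by rewrite /T /U -!mul_polyC -mul2n exprD exprMn -exprM mulnC; ring.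
Qed.

Let f_mul : ('X - g%:R%:P) ^+ 2 * f = (U + V + T * (U - V)) ^+ 2 - 4 * (T * U ^+ 2).
Proof.
rewrite fE TU -AE -scalerA -!mul_polyC; set E := _ * _ ^+ j.+1.
by rewrite (_ : (4 : rat)%:P = 4) ?rmorph_nat //; ring.
Qed.

(** With [S = U + V] and [D = U - V] one has [2 U = S + D], and [(S + T D)^2 - T (S + D)^2 = (1 - T)
    (S^2 - T D^2)]. *)
Lemma family_factor : ('X - g%:R%:P) ^+ 2 * f =
  (1 - T) * ((U + V) ^+ 2 - T * (U - V) ^+ 2).
Proof. by rewrite f_mul; ring. Qed.

Lemma norm_A : norm ((- A, 1) : chart f) =
  (4 * c) *: ('X^(n.+1.*2 + i.+1) * ('X - 1) ^+ j.+1).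
Proof. by rewrite /norm /= fE; ring. Qed.

(** [(S - T D)^2 - (S + T D)^2 = - 4 T (U^2 - V^2)], and adding [4 T U^2] leaves [4 T V^2]. *)
Lemma norm_B : norm ((- B, 'X - g%:R%:P) : chart f) =
  (4 * c) *: ('X^(i.+1) * ('X - 1) ^+ (g.*2 + j.+1)).
Proof.
rewrite /norm /= f_mul /B.
transitivity (4 * (T * V ^+ 2)); first ring.
rewrite /T /V -!mul_polyC -exprM muln2 exprD polyCM.
by rewrite (_ : (4 : rat)%:P = 4) ?rmorph_nat //; ring.
Qed.

(** Both [U] and [V] begin with [x^g - g x^(g-1)]. This cancellation is what bounds the degree of
    [A] by [g]. *)
Lemma size_sub_UV : (size (U - V)%R <= g.-1)%N.
Proof.
suff [r Er sr] : exists2 r : {poly rat},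
    V = 'X^g - g%:R%:P * 'X^(n.+1) + r & (size r <= n.+1)%N.
  by have -> : U - V = - r; [rewrite Er /U /g !exprS; ring | rewrite size_polyN].
rewrite /V /g; elim: (n) => [|m [r Er sr]].
  exists 1; last by rewrite size_poly1.
  by rewrite rmorph_nat; ring.
exists ('X * r + m.+2%:R%:P * 'X^(m.+1) - r).
  rewrite exprS Er !rmorph_nat -[m.+3%:R]natr1 !exprS; ring.
rewrite (leq_trans (size_polyD _ _)) // size_polyN geq_max (leq_trans sr) // andbT.
rewrite (leq_trans (size_polyD _ _)) // geq_max.
rewrite (leq_trans (size_polyMleq _ _)) ?size_polyX //=.
by rewrite mul_polyC (leq_trans (size_scale_leq _ _)) // size_polyXn.
Qed.

(** [A^2] has degree at most [2g], so the subtracted term, of degree [2g + 1], dominates. *)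
Lemma size_family : size f = (2 * g + 2)%N.
Proof.
have sT : (size T <= 4)%N.
  rewrite /T (leq_trans (size_scale_leq _ _)) //.
  rewrite size_mul ?expf_neq0 ?polyX_eq0 ?polyXsubC_eq0 //.
  by rewrite size_polyXn size_exp_XsubC; move: ij; lia.
have sU : (size U <= g.+1)%N.
  rewrite /U size_mul ?expf_neq0 ?polyX_eq0 ?polyXsubC_eq0 //.
  by rewrite size_XsubC size_polyXn.
have sV : (size V <= g.+1)%N by rewrite size_exp_XsubC.
have sA : (size A <= g.+1)%N.
  have [->|A0] := eqVneq A 0; first by rewrite size_poly0.
  have : (size (A * ('X - g%:R%:P))%R <= g.+2)%N.
    rewrite AE (leq_trans (size_polyD _ _)) // geq_max; apply/andP; split.
      by rewrite (leq_trans (size_polyD _ _)) // geq_max (leqW sU) (leqW sV).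
    rewrite (leq_trans (size_polyMleq _ _)) //; move: sT size_sub_UV.
    by move: (size T) (size _); rewrite /g; lia.
  by rewrite size_mul // size_XsubC addn2.
have sE : size ((4 * c) *: ('X^(n.+1.*2 + i.+1) * ('X - 1) ^+ j.+1) : {poly rat})
    = (2 * g + 2)%N.
  rewrite size_scale ?mulf_neq0 // size_mul ?expf_neq0 ?polyX_eq0 ?polyXsubC_eq0 //.
  by rewrite size_polyXn size_exp_XsubC; move: ij; rewrite /g; lia.
rewrite fE addrC size_polyDl size_polyN // sE.
rewrite (leq_ltn_trans (size_polyMleq _ _)) //; move: sA.
by move: (size A); rewrite /g; lia.
Qed.

Lemma A_at0 : A.[0] != 0.
Proof.
have U0 : U.[0] = 0 by rewrite /U hornerM hornerXn expr0n mulr0.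
have T0 : T.[0] = 0 by rewrite /T hornerZ hornerM hornerXn expr0n mul0r mulr0.
have V0 : V.[0] = (-1) ^+ g by rewrite /V horner_exp hornerXsubC sub0r.
have := congr1 (fun p : {poly rat} => p.[0]) AE.
rewrite /= hornerM !hornerD [(T * _).[0]]hornerM T0 mul0r addr0 U0 V0 add0r.
by apply: contra_eqN => /eqP->; rewrite mul0r eq_sym signr_eq0.
Qed.

Lemma A_at1 : A.[1] != 0.
Proof.
have T1 : T.[1] = 0.
  by rewrite /T hornerZ hornerM !horner_exp hornerXsubC subrr expr0n !mulr0.
have V1 : V.[1] = 0 by rewrite /V horner_exp hornerXsubC subrr expr0n.
have := congr1 (fun p : {poly rat} => p.[1]) AE.
rewrite /= hornerM !hornerD [(T * _).[1]]hornerM T1 mul0r !addr0 V1 addr0.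
rewrite /U hornerM hornerXn expr1n mulr1 hornerXsubC.
apply: contra_eqN => /eqP->; rewrite mul0r eq_sym subr_eq0 eq_sym pnatr_eq1.
by [].
Qed.

Let f_at0 : f.[0] = A.[0] ^+ 2.
Proof.
rewrite fE hornerD horner_exp hornerN hornerZ [('X^_ * _).[0]]hornerM hornerXn addnS.
by rewrite [0 ^+ _.+1]exprS !mul0r mulr0 subr0.
Qed.

Let f_at1 : f.[1] = A.[1] ^+ 2.
Proof.
rewrite fE hornerD horner_exp hornerN hornerZ [('X^_ * _).[1]]hornerM.
rewrite [(('X - 1) ^+ _).[1]]horner_exp hornerXsubC.
by rewrite subrr [0 ^+ _.+1]exprS mul0r !mulr0 subr0.
Qed.

Let P0_subproof : A.[0] ^+ 2 == f.[0]. Proof. exact/eqP/esym/f_at0. Qed.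
Let P1_subproof : A.[1] ^+ 2 == f.[1]. Proof. exact/eqP/esym/f_at1. Qed.

Let P0 : {p : rat * rat | p.2 ^+ 2 == f.[p.1]} :=
  exist (fun p : rat * rat => p.2 ^+ 2 == f.[p.1]) (0, A.[0]) P0_subproof.
Let P1 : {p : rat * rat | p.2 ^+ 2 == f.[p.1]} :=
  exist (fun p : rat * rat => p.2 ^+ 2 == f.[p.1]) (1, A.[1]) P1_subproof.

Let eval_A x : reg_eval ((- A, 1) : chart f) (x, A.[x]) = 0.
Proof. by rewrite /reg_eval /= hornerN hornerC mul1r addNr. Qed.

Let eval_conj_A x : A.[x] != 0 ->
  reg_eval (conj ((- A, 1) : chart f)) (x, A.[x]) != 0.
Proof.
move=> Ax; rewrite /reg_eval /= !hornerN hornerC mulN1r -opprD oppr_eq0.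
by rewrite -mulr2n mulrn_eq0.
Qed.

Let AgE x : (x - g%:R) * A.[x] = (U + V + T * (U - V)).[x].
Proof. by rewrite -AE hornerM hornerXsubC mulrC. Qed.

Let B_at x : T.[x] = 0 -> (- B).[x] = - ((x - g%:R) * A.[x]).
Proof.
move=> Tx; rewrite AgE hornerN /B [(_ - _).[x]]hornerD [(- (T * _)).[x]]hornerN.
by rewrite [(_ + T * _).[x]]hornerD [(T * _).[x]]hornerM Tx mul0r oppr0.
Qed.

Let eval_B x : T.[x] = 0 ->
  reg_eval ((- B, 'X - g%:R%:P) : chart f) (x, A.[x]) = 0.
Proof. by move=> /B_at E; rewrite /reg_eval /= E hornerXsubC addNr. Qed.

Let eval_conj_B x : T.[x] = 0 -> x - g%:R != 0 -> A.[x] != 0 ->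
  reg_eval (conj ((- B, 'X - g%:R%:P) : chart f)) (x, A.[x]) != 0.
Proof.
move=> /B_at E xg Ax; rewrite /reg_eval /= E [(- ('X - _)).[x]]hornerN hornerXsubC.
by rewrite mulNr -opprD oppr_eq0 -mulr2n mulrn_eq0 mulf_neq0.
Qed.

Let T_at0 : T.[0] = 0.
Proof. by rewrite /T hornerZ hornerM hornerXn exprS mul0r mul0r mulr0. Qed.

Let T_at1 : T.[1] = 0.
Proof.
by rewrite /T hornerZ hornerM !horner_exp hornerXsubC subrr [0 ^+ _]exprS mul0r !mulr0.
Qed.

Let g_at0 : 0 - g%:R != 0 :> rat.
Proof. by rewrite sub0r oppr_eq0 pnatr_eq0. Qed.

Let g_at1 : 1 - g%:R != 0 :> rat.
Proof. by rewrite subr_eq0 eq_sym pnatr_eq1. Qed.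

Let c4 : 4 * c != 0. Proof. by rewrite mulf_neq0. Qed.

(** The norms of [y - A] and [(x - g) y - B] give [2g P0 + P1 = 0] and [2 P0 + (2g + 1) P1 = 0]. *)
Lemma torsion_at0 : j = 0%N -> coprimep f f^`() ->
  exists P : point f, torsion_divisor g P (4 * g ^ 2 + 2 * g - 2).
Proof.
move=> j0 cop; exists (Some P0).
have i1 : i = 1%N by move: ij; rewrite j0 addn0.
apply: (@torsion_two_functions g f P0 P1 (2 * g) (2 * g + 1) _ (4 * c) (4 * c)
  ((- A, 1) : chart f) ((- B, 'X - g%:R%:P) : chart f)) => //=;
  rewrite ?eval_A ?eval_conj_A ?eval_B ?eval_conj_B ?A_at0 ?A_at1 //.
- exact: size_family.
- by rewrite norm_A j0 i1 subr0 expr1 /g; congr (_ *: ('X^_ * _)); lia.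
- by rewrite norm_B j0 i1 subr0 /g; congr (_ *: (_ * _ ^+ _)); lia.
- by rewrite /g; lia.
- by rewrite /g; lia.
- by rewrite /g; lia.
Qed.

(** The two functions and the two points exchange roles: [(2g + 2) P1 + P0 = 0] and
    [2 P1 + (2g - 1) P0 = 0]. *)
Lemma torsion_at1 : i = 0%N -> coprimep f f^`() ->
  exists P : point f, torsion_divisor g P (4 * g ^ 2 + 2 * g - 4).
Proof.
move=> i0 cop; exists (Some P1).
have j1 : j = 1%N by move: ij; rewrite i0.
apply: (@torsion_two_functions g f P1 P0 (2 * g + 2) (2 * g - 1) _ (4 * c) (4 * c)
  ((- B, 'X - g%:R%:P) : chart f) ((- A, 1) : chart f)) => //=;
  rewrite ?eval_A ?eval_conj_A ?eval_B ?eval_conj_B ?A_at0 ?A_at1 //.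
- exact: size_family.
- by rewrite norm_B i0 j1 subr0 expr1 ['X * _]mulrC /g; congr (_ *: (_ ^+ _ * _)); lia.
- by rewrite norm_A i0 j1 subr0 ['X^_ * _]mulrC /g; congr (_ *: (_ * 'X^_)); lia.
- by rewrite /g; lia.
- by rewrite /g; lia.
- by rewrite /g; lia.
Qed.

Hypothesis T_at_g : T.[g%:R] = 1.

Let derivT : T^`() =
  c *: (('X^i * ('X - 1) ^+ j) * (i.+1%:R * ('X - 1) + j.+1%:R * 'X)).
Proof.
rewrite /T derivZ derivM derivXn deriv_exp derivB derivX derivC subr0 mul1r /=.
by congr (_ *: _); rewrite -(mulr_natr 'X^i) -(mulr_natr (('X - 1) ^+ j)) !exprS; ring.
Qed.

Let derivU : U^`() = 'X^(n.+1) + (g%:R - 1) * ('X - g%:R%:P) * 'X^n.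
Proof.
have -> : g%:R - 1 = n.+1%:R :> {poly rat} by rewrite /g -[n.+2%:R]natr1 addrK.
by rewrite /U derivM derivXsubC derivXn mul1r /= -(mulr_natr 'X^n); ring.
Qed.

Let derivV : V^`() = g%:R * ('X - 1) ^+ n.+1.
Proof.
by rewrite /V deriv_exp derivB derivX derivC subr0 mul1r -mulr_natl.
Qed.

(** At [x = g] the identity [family_factor] is void, so [A(g)] is obtained by differentiating the
    numerator. With [p = g^(n+1)] and [q = (g - 1)^(n+1)] it is [2 p - th q], hence
    [f(g) = th q (th q - 4 p)], which is negative because [0 < th <= 3] and [0 < q <= p]. *)
Lemma family_at_g : f.[g%:R] != 0.
Proof.
set gr : rat := g%:R; set tau := T^`().[gr]; set p := gr ^+ n.+1.
have Ug : U.[gr] = 0 by rewrite /U hornerM hornerXsubC subrr mul0r.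
have dUg : U^`().[gr] = p.
  by rewrite derivU hornerD hornerXn !hornerM hornerXsubC subrr mulr0 mul0r addr0.
set v := V.[gr]; set dv := V^`().[gr].
have dl (a : {poly rat}) : (a * ('X - gr%:P))^`().[gr] = a.[gr].
  by rewrite derivM derivXsubC mulr1 hornerD hornerM hornerXsubC subrr mulr0 add0r.
have dr (a b h : {poly rat}) : (a + b + h * (a - b))^`().[gr] =
    a^`().[gr] + b^`().[gr] + (h^`().[gr] * (a.[gr] - b.[gr])
      + h.[gr] * (a^`().[gr] - b^`().[gr])).
  by rewrite !(derivD, derivM, derivN) !(hornerD, hornerM, hornerN).
have := congr1 (fun p : {poly rat} => p^`().[gr]) AE.
rewrite /= dl dr Ug dUg T_at_g mul1r -/tau -/v -/dv => Ag.
have g2 : 2 <= gr by rewrite /gr ler_nat.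
have cg : c * (gr ^+ i.+1 * (gr - 1) ^+ j.+1) = 1.
  by rewrite -[RHS]T_at_g /T hornerZ hornerM hornerXn horner_exp hornerXsubC.
pose th := tau * (gr - 1); pose q := (gr - 1) ^+ n.+1.
(* The logarithmic derivative of [T] at [g], where [T = 1]. *)
have thE : th * gr = 3 * gr - i.+1%:R.
  have -> : (3 : rat) = i.+1%:R + j.+1%:R.
    by rewrite -natrD addSn addnS ij.
  transitivity (c * (gr ^+ i.+1 * (gr - 1) ^+ j.+1)
                * (i.+1%:R * (gr - 1) + j.+1%:R * gr)); last by rewrite cg; ring.
  rewrite /th /tau derivT hornerZ hornerM [('X^i * _).[gr]]hornerM hornerXn horner_exp.
  rewrite hornerXsubC hornerD !hornerM hornerXsubC hornerX.
  have hn m : (m%:R : {poly rat}).[gr] = m%:R by rewrite -polyC_natr hornerC.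
  by rewrite !hn !exprS; ring.
have i2 : 0 < (i.+1%:R : rat) <= 2.
  by rewrite ltr0n ler_nat; move: ij; case: (i) => [|[|?]] //; lia.
have q0 : 0 < q by rewrite /q exprn_gt0 // subr_gt0; lra.
have qp : q <= p.
  by rewrite /q /p lerXn2r ?nnegrE //; lra.
have th0 : 0 < th.
  by rewrite -(pmulr_lgt0 _ (_ : 0 < gr)) ?thE; lra.
have th3 : th <= 3.
  by rewrite -(ler_pM2r (_ : 0 < gr)) ?thE; lra.
have AgE' : A.[gr] = 2 * p - th * q.
  rewrite Ag /v /V horner_exp hornerXsubC /th /q [(gr - 1) ^+ g]exprS; ring.
have -> : f.[gr] = th * q * (th * q - 4 * p).
  transitivity (A.[gr] ^+ 2 - 4 * (c * (gr ^+ i.+1 * (gr - 1) ^+ j.+1)) * p ^+ 2).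
    rewrite fE hornerD horner_exp hornerN hornerZ [('X^_ * _).[_]]hornerM hornerXn.
    rewrite horner_exp hornerXsubC exprD -muln2 exprM -/p; ring.
  by rewrite cg AgE'; ring.
apply: mulf_neq0; first by rewrite gt_eqF // mulr_gt0.
rewrite lt_eqF // subr_lt0.
by apply: le_lt_trans (ler_wpM2r (ltW q0) th3) _; lra.
Qed.

(** Evaluating [family_factor] and its derivative at a double root gives the two equations. At 0 and
    1 the value of [f] is a nonzero square, and [family_at_g] excludes [g]. *)
Lemma family_double_root (x : algC) (G := (g%:R : algC))
    (w := x ^+ n) (z := (x - 1) ^+ n)
    (t := (QtoC T).[x]) (dt := (QtoC T^`()).[x])
    (u := (x - G) * x * w) (du := x * w + (G - 1) * (x - G) * w)
    (v := (x - 1) ^+ 2 * z) (dv := G * (x - 1) * z) :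
  root (QtoC f) x -> root (QtoC f^`()) x ->
  [/\ x != 0, x - 1 != 0, x - G != 0,
    (1 - t) * ((u + v) ^+ 2 - t * (u - v) ^+ 2) = 0
  & - dt * ((u + v) ^+ 2 - t * (u - v) ^+ 2) + (1 - t) *
      (2 * (u + v) * (du + dv) - dt * (u - v) ^+ 2 - 2 * t * (u - v) * (du - dv)) = 0].
Proof.
move=> /rootP fx /rootP dfx.
have eval_rat (r : rat) : (QtoC f).[ratr r] = ratr f.[r] by rewrite horner_map.
have nroot (r : rat) : f.[r] != 0 -> x != ratr r.
  apply: contraNneq => xr; rewrite -(fmorph_eq0 (ratr : {rmorphism rat -> algC})) /=.
  by rewrite -eval_rat -xr fx.
have x0 : x != 0 by rewrite -(rmorph0 (ratr : {rmorphism rat -> algC})) nroot // f_at0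
  expf_neq0 // A_at0.
have x1 : x - 1 != 0.
  by rewrite subr_eq0 -(rmorph1 (ratr : {rmorphism rat -> algC})) nroot // f_at1
    expf_neq0 // A_at1.
have xG : x - G != 0.
  by rewrite subr_eq0 /G -(rmorph_nat (ratr : {rmorphism rat -> algC})) nroot //
    family_at_g.
pose e : {rmorphism {poly rat} -> algC} := horner_eval x \o QtoC.
have eX : e 'X = x by rewrite /e /= map_polyX horner_evalE hornerX.
have eG : e g%:R%:P = G by rewrite /e /= map_polyC horner_evalE hornerC /= rmorph_nat.
have ef : e f = 0 by [].
have edf : e f^`() = 0 by [].
have et : e T = t by [].
have edt : e T^`() = dt by [].
have eU : e U = u.
  by rewrite /U rmorphM rmorphB rmorphXn eX eG /u exprS mulrA.
have eV : e V = v.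
  by rewrite /V rmorphXn rmorphB eX rmorph1 /v /z -exprD.
have edU : e U^`() = du.
  rewrite derivU rmorphD !rmorphM !rmorphXn !rmorphB rmorph_nat rmorph1 eX eG.
  by rewrite /du /w exprS.
have edV : e V^`() = dv.
  by rewrite derivV rmorphM rmorphXn rmorphB rmorph1 rmorph_nat eX /dv exprS mulrA.
have E1 := congr1 e family_factor.
have E2 := congr1 (fun p => e p^`()) family_factor.
split=> //.
  have el (a b : {poly rat}) : e (a * b) = e a * e b by rewrite rmorphM.
  have er (a b h : {poly rat}) : e ((1 - h) * ((a + b) ^+ 2 - h * (a - b) ^+ 2)) =
      (1 - e h) * ((e a + e b) ^+ 2 - e h * (e a - e b) ^+ 2).
    by rewrite !expr2 !(rmorphM, rmorphB, rmorphD, rmorph1).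
  by move: E1; rewrite el er ef mulr0 eU eV et => <-.
have dl (a h : {poly rat}) : (a ^+ 2 * h)^`() = 2 * a * a^`() * h + a ^+ 2 * h^`().
  by rewrite expr2 !derivM; ring.
have dr (a b h : {poly rat}) : ((1 - h) * ((a + b) ^+ 2 - h * (a - b) ^+ 2))^`() =
    - h^`() * ((a + b) ^+ 2 - h * (a - b) ^+ 2) + (1 - h) *
      (2 * (a + b) * (a^`() + b^`()) - h^`() * (a - b) ^+ 2
       - 2 * h * (a - b) * (a^`() - b^`())).
  by rewrite !expr2 !(derivM, derivB, derivD, derivC); ring.
have el (a b h k : {poly rat}) : e (a * b + h * k) = e a * e b + e h * e k.
  by rewrite rmorphD !rmorphM.
have er (a b h a' b' h' : {poly rat}) :
  e (- h' * ((a + b) ^+ 2 - h * (a - b) ^+ 2) + (1 - h) *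
      (2 * (a + b) * (a' + b') - h' * (a - b) ^+ 2 - 2 * h * (a - b) * (a' - b'))) =
  - e h' * ((e a + e b) ^+ 2 - e h * (e a - e b) ^+ 2) + (1 - e h) *
      (2 * (e a + e b) * (e a' + e b') - e h' * (e a - e b) ^+ 2
       - 2 * e h * (e a - e b) * (e a' - e b')).
  by rewrite !expr2 !(rmorphD, rmorphB, rmorphN, rmorphM, rmorph1); ring.
rewrite dl dr el er ef edf !mulr0 addr0 in E2.
by rewrite -eU -eV -edU -edV -et -edt -{}E2.
Qed.

End Family.

(** * The two families *)

(* Numerals of a ring are unary, so the Bezout coefficients below, found by the
   Euclidean algorithm, are written in base 100. *)
Lemma bezout_nonzero (R : pzRingType) (a b s t c : R) :
  a = 0 -> b = 0 -> s * a + t * b = c -> c != 0 -> False.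
Proof. by move=> -> -> <-; rewrite !mulr0 addr0 eqxx. Qed.

Lemma quartic_intrE (a : int) (b x : algC) : a%:~R = b ->
  (map_poly intr (quartic a)).[x] =
  9 * x ^+ 4 + (8 * b - 16) * x ^+ 3 + (6 * b ^+ 2 - 8 * b + 8) * x ^+ 2
  + (3 * b ^+ 3 - 3 * b ^+ 2 + b - 1) * x + b ^+ 4.
Proof.
move=> <-; rewrite quarticE; do ![congr (_ + _)]; try congr (_ * _).
- by rewrite intrB intrM.
- by rewrite intrD intrB !intrM; ring.
- by rewrite intrB intrD intrB !intrM; ring.
- by rewrite rmorphXn.
Qed.

Ltac positive_numeral :=
  rewrite gt_eqF //; repeat first
    [ exact: ltr0n | apply: ltr_wpDr; [by rewrite ?ler0n|] | apply: mulr_gt0 ].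

(* In the coordinate [1 - x] the quartic of the first family is that of the second
   one, with [g - 1] replaced by [- g]. *)
Lemma no_common_root_t (n : nat) (x : algC) (g := (n.+2%:R : algC)) :
  9 * x ^+ 4 + (8 * g - 20) * x ^+ 3 + (6 * g ^+ 2 - 16 * g + 14) * x ^+ 2
    + 3 * (g - 1) ^+ 3 * x + g * (g - 1) ^+ 3 = 0 ->
  x * x ^+ n * (x ^+ 2 + (4 * g - 1) * x + g ^+ 2 - 3 * g)
    - (x - 1) ^+ 2 * (x - 1) ^+ n * (x - g - 1) = 0 -> False.
Proof.
rewrite {}/g; case: n => [|[|[|[|n]]]] HQ HR.
(* For [g] from 2 to 5 the constant term of the quartic does not dominate, and explicit Bezout
   relations are used. *)
- apply: (bezout_nonzero (c := 15 * 100 + 54) HQ HR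
    (s := (6 * 100 + 9) + (- (7 * 100 + 32)) * x)
    (t := (1 * 100 + 12) + (2 * 100 + 15) * x + (- (2 * 100 + 89)) * x ^+ 2
          + (5 * 100 + 49) * x ^+ 3));
    [by ring | by positive_numeral].
- apply: (bezout_nonzero (c := (((3 * 100 + 38) * 100 + 82) * 100 + 6) * 100 + 0) HQ HR
    (s := (((13 * 100 + 96) * 100 + 72) * 100 + 37)
          + (- (((14 * 100 + 19) * 100 + 18) * 100 + 51)) * x
          + (((4 * 100 + 96) * 100 + 7) * 100 + 46) * x ^+ 2)
    (t := (- ((90 * 100 + 17) * 100 + 28))
          + (- (((4 * 100 + 27) * 100 + 83) * 100 + 0)) * x
          + (((3 * 100 + 92) * 100 + 65) * 100 + 60) * x ^+ 2
          + (- (((2 * 100 + 48) * 100 + 3) * 100 + 73)) * x ^+ 3));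
    [by ring | by positive_numeral].
- apply: (bezout_nonzero HQ HR
    (c := (((((8 * 100 + 46) * 100 + 18) * 100 + 43) * 100 + 98) * 100 + 17) * 100 + 8)
    (s := (((((7 * 100 + 86) * 100 + 65) * 100 + 93) * 100 + 27) * 100 + 71)
          + (- (((((6 * 100 + 8) * 100 + 95) * 100 + 52) * 100 + 5) * 100 + 96)) * x
          + (((((1 * 100 + 69) * 100 + 34) * 100 + 52) * 100 + 77) * 100 + 22) * x ^+ 2
          + (- ((((17 * 100 + 52) * 100 + 47) * 100 + 83) * 100 + 44)) * x ^+ 3)
    (t := (- ((((68 * 100 + 15) * 100 + 35) * 100 + 15) * 100 + 12))
          + (((((1 * 100 + 23) * 100 + 30) * 100 + 65) * 100 + 76) * 100 + 33) * x
          + (- ((((48 * 100 + 71) * 100 + 79) * 100 + 42) * 100 + 93)) * x ^+ 2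
          + ((((6 * 100 + 57) * 100 + 17) * 100 + 93) * 100 + 79) * x ^+ 3));
    [by ring | by positive_numeral].
- apply: (bezout_nonzero HQ HR
    (c := ((((((((1 * 100 + 35) * 100 + 27) * 100 + 2) * 100 + 73) * 100 + 73) * 100 + 65) * 100 + 46) * 100 + 30) * 100 + 40)
    (s := (((((((42 * 100 + 35) * 100 + 80) * 100 + 9) * 100 + 70) * 100 + 84) * 100 + 94) * 100 + 97)
          + (- (((((((25 * 100 + 87) * 100 + 61) * 100 + 32) * 100 + 36) * 100 + 65) * 100 + 83) * 100 + 65)) * x
          + (((((((5 * 100 + 42) * 100 + 97) * 100 + 9) * 100 + 66) * 100 + 18) * 100 + 80) * 100 + 90) * x ^+ 2
          + (- ((((((31 * 100 + 95) * 100 + 14) * 100 + 98) * 100 + 68) * 100 + 10) * 100 + 50)) * x ^+ 3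
          + (- ((((((13 * 100 + 93) * 100 + 34) * 100 + 31) * 100 + 27) * 100 + 66) * 100 + 90)) * x ^+ 4)
    (t := (((((((4 * 100 + 58) * 100 + 92) * 100 + 88) * 100 + 84) * 100 + 39) * 100 + 60) * 100 + 0)
          + (- ((((((89 * 100 + 27) * 100 + 56) * 100 + 51) * 100 + 88) * 100 + 28) * 100 + 96)) * x
          + ((((((23 * 100 + 5) * 100 + 44) * 100 + 33) * 100 + 17) * 100 + 17) * 100 + 82) * x ^+ 2
          + ((((((4 * 100 + 18) * 100 + 0) * 100 + 29) * 100 + 38) * 100 + 30) * 100 + 7) * x ^+ 3));
    [by ring | by positive_numeral].
(* Now [m = g], and the indeterminate stands for [1 - x]: [l] is [x], [- 'X] is [x - 1], and [r] is
   the trinomial. *)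
pose m := n.+4.+2; pose a : int := - m%:Z.
pose l : {poly int} := 1 - 'X.
pose h : {poly int} := 'X^2 - (4 * m + 1)%:Z%:P * 'X + (m * m.+1)%:Z%:P.
pose r : {poly int} := l ^+ m.-1 * h + (- 'X) ^+ m * ('X + m%:Z%:P).
have aC : (a%:~R : algC) = - m%:R by rewrite /a rmorphN.
apply: (elimN idP (@no_common_root a (a - 1) r (1 - x) _ _ _ _ _)).
- by rewrite oppr_eq0.
- rewrite /quartic_dominated.
  (* In terms of [N = g - 6] all signs are constant and the difference has positive coefficients. *)
  pose N : int := n%:Z; have N0 : 0 <= N by [].
  have -> : a = - (N + 6) by rewrite /a /m /N; lia.
  have -> : 8 * - (N + 6) - 16 = - (8 * N + 64) by ring.
  have -> : 6 * (- (N + 6)) ^+ 2 - 8 * - (N + 6) + 8 = 6 * N ^+ 2 + 80 * N + 272 by ring.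
  have -> : 3 * (- (N + 6)) ^+ 3 - 3 * (- (N + 6)) ^+ 2 - (N + 6) - 1
            = - (3 * N ^+ 3 + 57 * N ^+ 2 + 361 * N + 763) by ring.
  rewrite !normrN !ger0_norm ?addr_ge0 ?mulr_ge0 ?exprn_ge0 // -subr_gt0.
  have -> : (- (N + 6)) ^+ 4 - (9 + (8 * N + 64) + (6 * N ^+ 2 + 80 * N + 272)
      + (3 * N ^+ 3 + 57 * N ^+ 2 + 361 * N + 763))
    = N ^+ 4 + 21 * N ^+ 3 + 153 * N ^+ 2 + 415 * N + 188 by ring.
  by rewrite ltr_wpDl ?addr_ge0 ?mulr_ge0 ?exprn_ge0.
- rewrite /r hornerD hornerM horner_exp [((- 'X) ^+ m * _).[0]]hornerM.
  rewrite [((- 'X) ^+ m).[0]]horner_exp hornerN hornerX oppr0 [0 ^+ m]exprS !mul0r addr0.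
  have -> : l.[0] = 1 by rewrite /l hornerD hornerN hornerX hornerC oppr0 addr0.
  have -> : h.[0] = (m * m.+1)%:Z.
    by rewrite /h !(hornerD, hornerN, hornerM, hornerX, hornerXn, hornerC); ring.
  by rewrite expr1n mul1r /a PoszM -addn1 PoszD; ring.
- by apply/coprimezP; exists (-1, 1) => /=; ring.
- by rewrite rootE (quartic_intrE _ aC) -HQ /m; apply/eqP; ring.
pose e : {rmorphism {poly int} -> algC} := horner_eval (1 - x) \o map_poly intr.
have eX : e 'X = 1 - x by rewrite /e /= map_polyX horner_evalE hornerX.
have eC (c : nat) : e c%:Z%:P = c%:R by rewrite /e /= map_polyC horner_evalE hornerC.
have el : e l = x by rewrite /l rmorphB rmorph1 eX subKr.
have eh : e h = (1 - x) ^+ 2 - (4 * m%:R + 1) * (1 - x) + m%:R * (m%:R + 1).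
  rewrite /h rmorphD rmorphB rmorphXn rmorphM eX !eC !natrD !natrM.
  by rewrite natr1.
have er : e r = x ^+ m.-1 * e h + (x - 1) ^+ m * (1 - x + m%:R).
  rewrite /r rmorphD rmorphM rmorphXn el [e (_ ^+ m * _)]rmorphM rmorphXn rmorphN.
  by rewrite [e ('X + _)]rmorphD eX eC opprB.
rewrite rootE; apply/eqP; transitivity (e r); first by [].
rewrite er eh -HR /m /= !exprS; ring.
Qed.

(** For [g] at least 5, [no_common_root] applies with [a = g - 1], the trinomial being [a] or [- a]
    at 0. The cases [g = 2, 3, 4] are explicit. *)
Lemma no_common_root_s (n : nat) (x : algC) (g := (n.+2%:R : algC)) :
  9 * x ^+ 4 + (8 * g - 24) * x ^+ 3 + (6 * g ^+ 2 - 20 * g + 22) * x ^+ 2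
    + (3 * (g - 1) ^+ 3 - 3 * (g - 1) ^+ 2 + g - 2) * x + (g - 1) ^+ 4 = 0 ->
  x * x ^+ n * (x ^+ 2 + (4 * g - 5) * x + (g - 1) * (g - 2))
    - (x - 1) ^+ 2 * (x - 1) ^+ n * (x - g + 1) = 0 -> False.
Proof.
rewrite {}/g; case: n => [|[|[|n]]] HQ HR.
- apply: (bezout_nonzero (c := 6 * 100 + 32) HQ HR
    (s := (6 * 100 + 57) + (- (8 * 100 + 46)) * x)
    (t := (- 25) + (7 * 100 + 71) * x + (- (14 * 100 + 79)) * x ^+ 2
          + (12 * 100 + 69) * x ^+ 3));
    [by ring | by positive_numeral].
- apply: (bezout_nonzero (c := ((6 * 100 + 33) * 100 + 22) * 100 + 0) HQ HR
    (s := ((40 * 100 + 87) * 100 + 78) + (- ((41 * 100 + 3) * 100 + 39)) * x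
          + ((11 * 100 + 65) * 100 + 56) * x ^+ 2)
    (t := ((10 * 100 + 41) * 100 + 24) + (- ((26 * 100 + 12) * 100 + 21)) * x
          + ((25 * 100 + 67) * 100 + 61) * x ^+ 2
          + (- ((8 * 100 + 74) * 100 + 17)) * x ^+ 3));
    [by ring | by positive_numeral].
- apply: (bezout_nonzero HQ HR
    (c := ((((20 * 100 + 76) * 100 + 64) * 100 + 77) * 100 + 15) * 100 + 84)
    (s := ((((25 * 100 + 94) * 100 + 17) * 100 + 82) * 100 + 15)
          + (- ((((19 * 100 + 45) * 100 + 87) * 100 + 74) * 100 + 52)) * x
          + ((((4 * 100 + 49) * 100 + 75) * 100 + 83) * 100 + 62) * x ^+ 2
          + (((33 * 100 + 54) * 100 + 98) * 100 + 58) * x ^+ 3)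
    (t := (- ((((8 * 100 + 21) * 100 + 22) * 100 + 12) * 100 + 77))
          + ((((5 * 100 + 55) * 100 + 40) * 100 + 56) * 100 + 57) * x
          + (- ((((2 * 100 + 50) * 100 + 97) * 100 + 35) * 100 + 15)) * x ^+ 2
          + (- (((16 * 100 + 77) * 100 + 49) * 100 + 29)) * x ^+ 3));
    [by ring | by positive_numeral].
pose m := n.+4; pose a : int := m%:Z.
pose h : {poly int} := 'X^2 + (4 * a - 1)%:P * 'X + (a * (a - 1))%:P.
pose r : {poly int} := 'X^m * h - ('X - 1) ^+ m.+1 * ('X - a%:P).
have aC : (a%:~R : algC) = m%:R by [].
have gC : (n.+3.+2%:R : algC) = m%:R + 1 by rewrite natr1.
rewrite !gC in HQ HR.
apply: (elimN idP (@no_common_root a ((-1) ^+ m.+1) r x _ _ _ _ _)).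
- by [].
- rewrite /quartic_dominated.
  pose N : int := n%:Z; have N0 : 0 <= N by [].
  have -> : a = N + 4 by rewrite /a /m /N; lia.
  have -> : 8 * (N + 4) - 16 = 8 * N + 16 by ring.
  have -> : 6 * (N + 4) ^+ 2 - 8 * (N + 4) + 8 = 6 * N ^+ 2 + 40 * N + 72 by ring.
  have -> : 3 * (N + 4) ^+ 3 - 3 * (N + 4) ^+ 2 + (N + 4) - 1
            = 3 * N ^+ 3 + 33 * N ^+ 2 + 121 * N + 147 by ring.
  rewrite !ger0_norm ?addr_ge0 ?mulr_ge0 ?exprn_ge0 // -subr_gt0.
  have -> : (N + 4) ^+ 4 - (9 + (8 * N + 16) + (6 * N ^+ 2 + 40 * N + 72)
      + (3 * N ^+ 3 + 33 * N ^+ 2 + 121 * N + 147))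
    = N ^+ 4 + 13 * N ^+ 3 + 57 * N ^+ 2 + 87 * N + 12 by ring.
  by rewrite ltr_wpDl ?addr_ge0 ?mulr_ge0 ?exprn_ge0.
- rewrite /r hornerD hornerM hornerXn [0 ^+ m]exprS !mul0r add0r hornerN hornerM.
  by rewrite horner_exp !hornerXsubC !sub0r mulrN opprK mulrC.
- by rewrite coprimezXl // /coprimez -[1]opprK gcdNz gcd1z.
- by rewrite rootE (quartic_intrE _ aC) -HQ; apply/eqP; ring.
pose e : {rmorphism {poly int} -> algC} := horner_eval x \o map_poly intr.
have eX : e 'X = x by rewrite /e /= map_polyX horner_evalE hornerX.
have eC (c : int) : e c%:P = c%:~R by rewrite /e /= map_polyC horner_evalE hornerC.
have eh : e h = x ^+ 2 + (4 * m%:R - 1) * x + m%:R * (m%:R - 1).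
  by rewrite /h rmorphD eC rmorphD rmorphXn rmorphM eX eC !(intrB, intrM) aC.
have er : e r = x ^+ m * e h - (x - 1) ^+ m.+1 * (x - m%:R).
  rewrite /r rmorphB rmorphM rmorphXn eX [e (_ ^+ m.+1 * _)]rmorphM rmorphXn.
  by rewrite !rmorphB rmorph1 eX eC.
rewrite rootE; apply/eqP; transitivity (e r); first by [].
by rewrite er eh -HR /m !exprS; ring.
Qed.

Lemma family_t_data (n : nat) (g := n.+2) :
  [/\ t_ g != 0,
      A_gm1 g * ('X - g%:R%:P) =
        ('X - g%:R%:P) * 'X^(n.+1) + ('X - 1) ^+ g + t_ g *: ('X^2 * ('X - 1) ^+ 1)
          * (('X - g%:R%:P) * 'X^(n.+1) - ('X - 1) ^+ g),
      f_t g = A_gm1 g ^+ 2 - (4 * t_ g) *: ('X^(n.+1.*2 + 2) * ('X - 1) ^+ 1)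
    & (t_ g *: ('X^2 * ('X - 1) ^+ 1)).[g%:R] = 1].
Proof.
have nz : (g ^ 2 * (g - 1))%N%:R != 0 :> rat by rewrite pnatr_eq0.
split.
- by rewrite /t_ mulf_neq0 // invr_eq0.
- by rewrite A_gm1E.
- by rewrite /f_t; congr (_ - _ *: ('X^_ * _)); rewrite /g; lia.
- rewrite hornerZ hornerM hornerXn expr1 hornerXsubC /t_ mul1r.
  by rewrite -[1]/(1%N%:R) -natrB // -natrX -natrM mulVf.
Qed.

Lemma family_s_data (n : nat) (g := n.+2) :
  [/\ s_ g != 0,
      A_gm2 g * ('X - g%:R%:P) =
        ('X - g%:R%:P) * 'X^(n.+1) + ('X - 1) ^+ g + s_ g *: ('X^1 * ('X - 1) ^+ 2)
          * (('X - g%:R%:P) * 'X^(n.+1) - ('X - 1) ^+ g),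
      f_s g = A_gm2 g ^+ 2 - (4 * s_ g) *: ('X^(n.+1.*2 + 1) * ('X - 1) ^+ 2)
    & (s_ g *: ('X^1 * ('X - 1) ^+ 2)).[g%:R] = 1].
Proof.
have nz : (g * (g - 1) ^ 2)%N%:R != 0 :> rat by rewrite pnatr_eq0.
split.
- by rewrite /s_ mulf_neq0 // invr_eq0.
- by rewrite A_gm2E.
- by rewrite /f_s; congr (_ - _ *: ('X^_ * _)); rewrite /g; lia.
- rewrite hornerZ hornerM hornerXn expr1 horner_exp hornerXsubC /s_ mul1r.
  by rewrite -[1]/(1%N%:R) -natrB // -natrX -natrM mulVf.
Qed.

Lemma ratr_inv_nat (m : nat) : (0 < m)%N -> ratr (1 / m%:R : rat) * m%:R = 1 :> algC.
Proof.
by move=> m0; rewrite fmorph_div rmorph1 rmorph_nat mulfVK // pnatr_eq0 -lt0n.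
Qed.

Lemma QtoC_X1 : QtoC ('X - 1) = 'X - 1%:P.
Proof. by rewrite rmorphB rmorph1 /= map_polyX. Qed.

Lemma coprime_t (n : nat) : coprimep (f_t n.+2) (f_t n.+2)^`().
Proof.
have [c0 AE fE Tg] := family_t_data n.
apply: coprimep_of_roots => [|x fx].
  by rewrite -size_poly_gt0 (@size_family n 1 0 _ _ _ erefl c0 AE fE) addn2.
apply/negP => dfx.
have [x0 x1 xg r1 r2] := @family_double_root n 1 0 _ _ _ erefl AE fE Tg x fx dfx.
set g : algC := n.+2%:R in xg r1 r2.
pose t : algC := ratr (t_ n.+2).
have tg : t * (g ^+ 2 * (g - 1)) = 1.
  rewrite -[RHS](@ratr_inv_nat (n.+2 ^ 2 * (n.+2 - 1))) //; congr (_ * _).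
  by rewrite natrM natrX natrB.
have ET : (QtoC (t_ n.+2 *: ('X^2 * ('X - 1) ^+ 1))).[x] = t * (x ^+ 2 * (x - 1)).
  rewrite expr1 map_polyZ hornerZ [QtoC (_ * _)]rmorphM /= map_polyXn QtoC_X1.
  by rewrite hornerM hornerXn hornerXsubC.
have EdT : (QtoC (t_ n.+2 *: ('X^2 * ('X - 1) ^+ 1))^`()).[x] = t * (x * (3 * x - 2)).
  rewrite derivZ map_polyZ hornerZ; congr (_ * _).
  have -> : ('X^2 * ('X - 1) ^+ 1 : {poly rat})^`() = 'X * (3%:R%:P * 'X - 2%:R%:P).
    by rewrite expr1 derivM derivXn derivB derivX derivC /= !rmorph_nat; ring.
  rewrite rmorphM rmorphB rmorphM /= map_polyX !map_polyC /= !rmorph_nat.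
  by rewrite !(hornerM, hornerD, hornerN, hornerX, hornerC).
move: t tg ET EdT => t tg ET EdT.
(* [T' = 0] forces [3 x = 2], where [T = - 4 t / 27]; this is not 1, as [t] is positive. *)
have simple : (QtoC (t_ n.+2 *: ('X^2 * ('X - 1) ^+ 1))).[x] = 1 ->
    (QtoC (t_ n.+2 *: ('X^2 * ('X - 1) ^+ 1))^`()).[x] != 0.
  rewrite ET EdT => E; apply/eqP => /eqP.
  have t0 : t != 0 by apply: contra_eqN tg => /eqP->; rewrite mul0r eq_sym oner_eq0.
  rewrite !mulf_eq0 (negPf t0) (negPf x0) /= subr_eq0 => /eqP x32.
  have /eqP : 27 * (g ^+ 2 * (g - 1)) + 4 = 0.
    transitivity (27 * (g ^+ 2 * (g - 1)) * (t * (x ^+ 2 * (x - 1))) + 4).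
      by rewrite E mulr1.
    transitivity (t * (g ^+ 2 * (g - 1)) * ((3 * x) ^+ 2 * (3 * x - 3)) + 4); first ring.
    by rewrite tg x32; ring.
  have -> : g - 1 = n.+1%:R by rewrite /g -natr1 addrK.
  by rewrite -natrX -!natrM -natrD pnatr_eq0 addn_eq0 andbF.
have two : (2 : algC) != 0 by rewrite pnatr_eq0.
have [HQ HR] := double_root_t two x0 x1 xg (expf_neq0 n x0) (expf_neq0 n x1) r1 r2
  simple tg ET EdT.
exact: no_common_root_t HQ HR.
Qed.

Lemma coprime_s (n : nat) : coprimep (f_s n.+2) (f_s n.+2)^`().
Proof.
have [c0 AE fE Tg] := family_s_data n.
apply: coprimep_of_roots => [|x fx].
  by rewrite -size_poly_gt0 (@size_family n 0 1 _ _ _ erefl c0 AE fE) addn2.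
apply/negP => dfx.
have [x0 x1 xg r1 r2] := @family_double_root n 0 1 _ _ _ erefl AE fE Tg x fx dfx.
set g : algC := n.+2%:R in xg r1 r2.
pose t : algC := ratr (s_ n.+2).
have tg : t * (g * (g - 1) ^+ 2) = 1.
  rewrite -[RHS](@ratr_inv_nat (n.+2 * (n.+2 - 1) ^ 2)) //; congr (_ * _).
  by rewrite natrM natrX natrB.
have ET : (QtoC (s_ n.+2 *: ('X^1 * ('X - 1) ^+ 2))).[x] = t * (x * (x - 1) ^+ 2).
  rewrite expr1 map_polyZ hornerZ [QtoC (_ * _)]rmorphM rmorphXn /= map_polyX QtoC_X1.
  by rewrite hornerM horner_exp hornerX hornerXsubC.
have EdT : (QtoC (s_ n.+2 *: ('X^1 * ('X - 1) ^+ 2))^`()).[x]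
    = t * ((x - 1) * (3 * x - 1)).
  rewrite derivZ map_polyZ hornerZ; congr (_ * _).
  have -> : ('X^1 * ('X - 1) ^+ 2 : {poly rat})^`() = ('X - 1) * (3%:R%:P * 'X - 1).
    by rewrite expr1 expr2 !derivM derivX derivB derivX derivC /= !rmorph_nat; ring.
  rewrite rmorphM !rmorphB rmorphM rmorph1 /= map_polyX !map_polyC /= !rmorph_nat.
  by rewrite !(hornerM, hornerD, hornerN, hornerX, hornerC).
move: t tg ET EdT => t tg ET EdT.
(* [T' = 0] forces [3 x = 1], and [T = 1] would then mean [27 g (g - 1)^2 = 4], impossible for
   integers. *)
have simple : (QtoC (s_ n.+2 *: ('X^1 * ('X - 1) ^+ 2))).[x] = 1 ->
    (QtoC (s_ n.+2 *: ('X^1 * ('X - 1) ^+ 2))^`()).[x] != 0.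
  rewrite ET EdT => E; apply/eqP => /eqP.
  have t0 : t != 0 by apply: contra_eqN tg => /eqP->; rewrite mul0r eq_sym oner_eq0.
  rewrite !mulf_eq0 (negPf t0) (negPf x1) /= subr_eq0 => /eqP x31.
  have : 27 * (g * (g - 1) ^+ 2) = 4.
    transitivity (27 * (g * (g - 1) ^+ 2) * (t * (x * (x - 1) ^+ 2))).
      by rewrite E mulr1.
    transitivity (t * (g * (g - 1) ^+ 2) * (3 * x * (3 * x - 3) ^+ 2)); first ring.
    by rewrite tg x31; ring.
  have -> : g - 1 = n.+1%:R by rewrite /g -natr1 addrK.
  rewrite -natrX -!natrM => /eqP; rewrite eqr_nat => /eqP; nia.
have two : (2 : algC) != 0 by rewrite pnatr_eq0.
have [HQ HR] := double_root_s two x0 x1 xg (expf_neq0 n x0) (expf_neq0 n x1) r1 r2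
  simple tg ET EdT.
exact: no_common_root_s HQ HR.
Qed.

Theorem theorem3p2 (g : nat) (hg : (2 <= g)%N) :
  [/\ hyperelliptic g (f_t g),
      hyperelliptic g (f_s g),
      (exists P : point (f_t g),
         torsion_divisor g P (4 * g ^ 2 + 2 * g - 2)%N)
    & (exists P : point (f_s g),
         torsion_divisor g P (4 * g ^ 2 + 2 * g - 4)%N)].
Proof.
case: g hg => [|[|n]] // _.
have [t0 AtE ftE _] := family_t_data n; have [s0 AsE fsE _] := family_s_data n.
split.
- exact: hyperelliptic_coprime (@size_family n 1 0 _ _ _ erefl t0 AtE ftE) (coprime_t n).
- exact: hyperelliptic_coprime (@size_family n 0 1 _ _ _ erefl s0 AsE fsE) (coprime_s n).
- exact: (@torsion_at0 n 1 0 _ _ _ erefl t0 AtE ftE erefl (coprime_t n)).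
- exact: (@torsion_at1 n 0 1 _ _ _ erefl s0 AsE fsE erefl (coprime_s n)).
Qed.
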